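(* Let $X$ be a Peano graph whose ground space $\operatorname{Gr}(X)$ is homeomorphic to $V\times P$, where $V$ is a compact zero-dimensional metrizable space and $P$ is a Peano continuum with more than one point. Then the edge set admits a partition $E(X)=E_1\sqcup E_2$ such that for $i=1,2$ the closure $\overline{\bigcup E_i}$ contains $\operatorname{Gr}(X)$ and $\overline{\bigcup E_i}=\operatorname{Gr}(X)\cup\bigcup E_i$ is locally connected.
   Context: A Peano continuum is a compact connected locally connected metrizable space. A free arc (edge) is an inclusion-maximal open subset homeomorphic to $(0,1)$; $E(X)$ is the set of edges and $\operatorname{Gr}(X)=X\setminus\bigcup E(X)$ the ground space. A Peano graph is a Peano continuum in which $\bigcup E(X)$ is dense. *)

(* Defs.v *)
From Stdlib Require Import Reals List Classical.
Open Scope R_scope.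

Record TopSpace := {
  pt :> Type;
  is_open : (pt -> Prop) -> Prop;
  open_full : is_open (fun _ => True);
  open_inter : forall U V, is_open U -> is_open V -> is_open (fun x => U x /\ V x);
  open_union : forall F : (pt -> Prop) -> Prop,
      (forall U, F U -> is_open U) -> is_open (fun x => exists U, F U /\ U x)
}.
Arguments is_open {t} _.

Section Topo.
Variable X : TopSpace.

Definition full : X -> Prop := fun _ => True.

Definition closure (S : X -> Prop) : X -> Prop :=
  fun x => forall U, is_open U -> U x -> exists y, U y /\ S y.

Definition clopen (C : X -> Prop) : Prop :=
  is_open C /\ is_open (fun x => ~ C x).

Definition compact_set (A : X -> Prop) : Prop :=
  forall F : (X -> Prop) -> Prop,
    (forall U, F U -> is_open U) ->
    (forall x, A x -> exists U, F U /\ U x) ->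
    exists l : list (X -> Prop),
      (forall U, In U l -> F U) /\ (forall x, A x -> exists U, In U l /\ U x).

Definition connected_set (A : X -> Prop) : Prop :=
  ~ exists U V, is_open U /\ is_open V /\
      (forall x, A x -> U x \/ V x) /\
      (exists x, A x /\ U x) /\ (exists x, A x /\ V x) /\
      (forall x, A x -> U x -> V x -> False).

Definition locally_connected_set (A : X -> Prop) : Prop :=
  forall x U, A x -> is_open U -> U x ->
    exists W, is_open W /\ W x /\
      (forall y, A y -> W y -> U y) /\
      connected_set (fun y => A y /\ W y).

Definition is_metric_on (A : X -> Prop) (d : X -> X -> R) : Prop :=
  (forall x y, A x -> A y -> 0 <= d x y) /\
  (forall x y, A x -> A y -> (d x y = 0 <-> x = y)) /\
  (forall x y, A x -> A y -> d x y = d y x) /\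
  (forall x y z, A x -> A y -> A z -> d x z <= d x y + d y z).

Definition metrizable_set (A : X -> Prop) : Prop :=
  exists d : X -> X -> R, is_metric_on A d /\
    forall S : X -> Prop, (forall x, S x -> A x) ->
      ((exists U, is_open U /\ forall x, S x <-> (A x /\ U x)) <->
       (forall x, S x -> exists eps, 0 < eps /\
           forall y, A y -> d x y < eps -> S y)).

Definition peano_continuum : Prop :=
  (exists x : X, True) /\ compact_set full /\ connected_set full /\
  locally_connected_set full /\ metrizable_set full.

Definition zero_dimensional : Prop :=
  forall (x : X) U, is_open U -> U x -> exists C, clopen C /\ C x /\ forall y, C y -> U y.

Definition homeo_open_interval (A : X -> Prop) : Prop :=
  exists h : R -> X,
    (forall x, A x <-> exists t, 0 < t < 1 /\ h t = x) /\
    (forall s t, 0 < s < 1 -> 0 < t < 1 -> h s = h t -> s = t) /\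
    (forall t U, 0 < t < 1 -> is_open U -> U (h t) ->
       exists delta, 0 < delta /\
         forall s, 0 < s < 1 -> Rabs (s - t) < delta -> U (h s)) /\
    (forall t eps, 0 < t < 1 -> 0 < eps ->
       exists U, is_open U /\ U (h t) /\
         forall s, 0 < s < 1 -> U (h s) -> Rabs (s - t) < eps).

Definition edge (A : X -> Prop) : Prop :=
  is_open A /\ homeo_open_interval A /\
  forall B, is_open B -> homeo_open_interval B ->
    (forall x, A x -> B x) -> forall x, B x -> A x.

Definition bigU (E : (X -> Prop) -> Prop) : X -> Prop :=
  fun x => exists e, E e /\ e x.

Definition ground : X -> Prop := fun x => ~ bigU edge x.

Definition peano_graph : Prop :=
  peano_continuum /\ forall x, closure (bigU edge) x.

End Topo.

Arguments full {X} _.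
Arguments closure {X} _ _.
Arguments clopen {X} _.
Arguments compact_set {X} _.
Arguments connected_set {X} _.
Arguments locally_connected_set {X} _.
Arguments metrizable_set {X} _.
Arguments edge {X} _.
Arguments bigU {X} _ _.
Arguments ground {X} _.

Definition prod_open (V P : TopSpace) (W : V * P -> Prop) : Prop :=
  forall v p, W (v, p) -> exists U O, is_open U /\ is_open O /\ U v /\ O p /\
    forall v' p', U v' -> O p' -> W (v', p').

Definition homeomorphic_to_product (X : TopSpace) (A : X -> Prop) (V P : TopSpace) : Prop :=
  exists (f : {x : X | A x} -> V * P) (g : V * P -> {x : X | A x}),
    (forall a, g (f a) = a) /\ (forall q, f (g q) = q) /\
    (forall W, prod_open V P W ->
       exists U, is_open U /\ forall a, W (f a) <-> U (proj1_sig a)) /\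
    (forall U, is_open U -> prod_open V P (fun q => U (proj1_sig (g q)))).

(* Main.v *)
Require Import Defs.
From Stdlib Require Import Reals List Classical.
From Stdlib Require Import Ranalysis5 ClassicalEpsilon FunctionalExtensionality PropExtensionality.
From Stdlib Require Import Lra Lia.

(* Write [Gr(X)] as [V * P]. Each edge has two ends and these lie in [Gr(X)]: an end inside another
   edge would contradict maximality or make [X] a circle. If a small connected open set meets the
   fibres over both sides of a clopen cut of [V], it contains a whole edge crossing the cut. Hence,
   for [q] in [P] and [r > 0], the edges lying in [r]-balls around [V * {q}] decompose [V] into
   finitely many clopen classes that no clopen cut splits without being crossed by such an edge.

   Choose finite, increasingly dense sets [Q n] in [P], consecutive ones disjoint, and radii [r n]
   so rapidly decreasing that balls around consecutive [Q n] are disjoint and an edge of size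
   [r (n + 1)] crosses no class of level [n]. The level [n] edges are those in an [r n]-ball around
   [V * Q n] that fit in no [r (n + 3)]-ball. Even and odd levels are disjoint: levels that are three
   or more apart by size, adjacent ones by position. The edges of one parity alone already connect
   [W * O], for [W] a class and [O] a small connected open set in [P], because a clopen cut of [W]
   splits some class of a later level into pieces joined by a long edge. They are dense at [Gr(X)]
   because edges form a null sequence and [P] has no isolated points. *)

(** Fibres over distinct points of [V] are connected to each other only through edges, so splitting
    the edges threatens local connectedness at the ground space, and each half must restore it
    alone. This is possible because [{w} * O] is in one piece when [O] is connected: it does not
    matter at which height over [P] two such sets are joined. Edges near a single slice [V * {q}]
    suffice, and different slices can be reserved for different classes. Slices alone cannot keep
    all levels apart, since the sets [Q n] become dense; hence size as a second criterion. An edge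
    joining different classes of level [n + 2], the next level of the same parity, has ends more
    than [2 * r (n + 3)] apart, which is the origin of the shift by 3. Levels [n] and [n + 2] may
    share edges, harmlessly. Edges of no level may go to either side: connectedness is proved for
    any family of edges that contains all levels of one parity. *)

Lemma pred_ext {T : Type} (A B : T -> Prop) : (forall x, A x <-> B x) -> A = B.
Proof.
  intros H. apply functional_extensionality. intros x.
  apply propositional_extensionality. apply H.
Qed.

(** * Connectedness, clopen sets and compactness *)

Section Topology.
Context {X : TopSpace}.

Lemma open_local (A : X -> Prop) :
  (forall x, A x -> exists U, is_open U /\ U x /\ forall y, U y -> A y) -> is_open A.
Proof.
  intros H.
  replace A with (fun x => exists U, (is_open U /\ forall y, U y -> A y) /\ U x).
  - apply open_union. tauto.
  - apply pred_ext. intros x. split.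
    + intros (U & (_ & HU) & Ux). auto.
    + intros Ax. destruct (H x Ax) as (U & oU & Ux & HU). exists U. tauto.
Qed.

Lemma open_or (U V : X -> Prop) : is_open U -> is_open V -> is_open (fun x => U x \/ V x).
Proof.
  intros oU oV. apply open_local. intros x [Hx | Hx]; [exists U | exists V]; auto.
Qed.

Lemma closure_incl (A B : X -> Prop) :
  (forall x, A x -> B x) -> forall x, closure A x -> closure B x.
Proof.
  intros H x Hx U oU Ux. destruct (Hx U oU Ux) as (y & Uy & Ay). eauto.
Qed.

Lemma subset_closure (A : X -> Prop) x : A x -> closure A x.
Proof. intros Ax U _ Ux. eauto. Qed.

Lemma open_not_closure (A : X -> Prop) : is_open (fun x => ~ closure A x).
Proof.
  apply open_local. intros x Hx.
  apply not_all_ex_not in Hx. destruct Hx as (U & HU).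
  apply imply_to_and in HU. destruct HU as (oU & HU).
  apply imply_to_and in HU. destruct HU as (Ux & HU).
  exists U. auto 6.
Qed.

Lemma not_closure_nbhd (A : X -> Prop) x :
  ~ closure A x -> exists U, is_open U /\ U x /\ forall y, U y -> ~ A y.
Proof.
  intros Hx. exists (fun y => ~ closure A y).
  split; [apply open_not_closure | split; [exact Hx | ]].
  intros y Hy Ay. apply Hy, subset_closure, Ay.
Qed.

Lemma connected_intro (C : X -> Prop) :
  (forall U V x y, is_open U -> is_open V -> (forall z, C z -> U z \/ V z) ->
     (forall z, C z -> U z -> V z -> False) -> C x -> U x -> C y -> V y -> False) ->
  connected_set C.
Proof.
  intros H (U & V & oU & oV & cov & (x & Cx & Ux) & (y & Cy & Vy) & dis).
  exact (H U V x y oU oV cov dis Cx Ux Cy Vy).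
Qed.

Lemma connected_side (C U V : X -> Prop) x y :
  connected_set C -> is_open U -> is_open V -> (forall z, C z -> U z \/ V z) ->
  (forall z, C z -> U z -> V z -> False) -> C x -> U x -> C y -> U y.
Proof.
  intros cC oU oV cov dis Cx Ux Cy. destruct (cov y Cy) as [ | Vy]; auto.
  exfalso. apply cC. exists U, V. repeat split; eauto.
Qed.

Lemma connected_star (C : X -> Prop) x :
  (forall y, C y -> exists D, connected_set D /\ D x /\ D y /\ forall z, D z -> C z) ->
  connected_set C.
Proof.
  intros H. apply connected_intro. intros U V y z oU oV cov dis Cy Uy Cz Vz.
  destruct (H y Cy) as (D & cD & Dx & Dy & DC).
  destruct (H z Cz) as (D' & cD' & Dx' & Dz & DC').
  assert (Ux : U x) by (apply (connected_side D U V y x); eauto).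
  assert (Uz : U z) by (apply (connected_side D' U V x z); eauto).
  eauto.
Qed.

Lemma connected_union (C D : X -> Prop) x :
  connected_set C -> connected_set D -> C x -> D x -> connected_set (fun y => C y \/ D y).
Proof.
  intros cC cD Cx Dx. apply (connected_star _ x). intros y [Hy | Hy]; [exists C | exists D]; auto.
Qed.

Lemma connected_between_closure (C D : X -> Prop) :
  connected_set D -> (forall x, D x -> C x) -> (forall x, C x -> closure D x) ->
  connected_set C.
Proof.
  intros cD DC CD. apply connected_intro. intros U V x y oU oV cov dis Cx Ux Cy Vy.
  destruct (CD x Cx U oU Ux) as (x' & Ux' & Dx').
  destruct (CD y Cy V oV Vy) as (y' & Vy' & Dy').
  assert (U y') by (apply (connected_side D U V x' y'); eauto).
  eauto.
Qed.

Lemma connected_add_point (D : X -> Prop) g :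
  connected_set D -> closure D g -> connected_set (fun y => D y \/ y = g).
Proof.
  intros cD Hg. apply (connected_between_closure _ D); auto.
  intros x [Hx | ->]; auto using subset_closure.
Qed.

Lemma connected_clopen (C : X -> Prop) x y :
  connected_set (@full X) -> is_open C -> is_open (fun z => ~ C z) -> C x -> C y.
Proof.
  intros cX oC oC' Cx. apply (connected_side full C (fun z => ~ C z) x y); auto.
  - intros z _. apply classic.
  - exact I.
  - exact I.
Qed.

Lemma clopen_compl (C : X -> Prop) : clopen C -> clopen (fun x => ~ C x).
Proof.
  intros [H1 H2]. split; auto. replace (fun x => ~ ~ C x) with C; auto.
  apply pred_ext. intros x. split; [tauto | apply NNPP].
Qed.

Lemma clopen_and (C D : X -> Prop) : clopen C -> clopen D -> clopen (fun x => C x /\ D x).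
Proof.
  intros [H1 H2] [H3 H4]. split; [apply open_inter; auto | ].
  replace (fun x => ~ (C x /\ D x)) with (fun x => ~ C x \/ ~ D x).
  - apply open_or; auto.
  - apply pred_ext. intros x. split; [tauto | apply not_and_or].
Qed.

Lemma connected_nbhd (x : X) U :
  locally_connected_set (@full X) -> is_open U -> U x ->
  exists W, is_open W /\ W x /\ (forall y, W y -> U y) /\ connected_set W.
Proof.
  intros lc oU Ux. destruct (lc x U I oU Ux) as (W & oW & Wx & WU & cW).
  exists W. repeat split; auto.
  - intros y Wy. apply WU; auto. exact I.
  - replace W with (fun y : X => full y /\ W y); auto.
    apply pred_ext. intros y. unfold full. tauto.
Qed.

(** Finite subcovers are used only through this principle, with [Phi U] saying that one constant or
    one finite list serves all of [U]. *)
Lemma compact_induction (Phi : (X -> Prop) -> Prop) :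
  compact_set (@full X) -> Phi (fun _ => False) ->
  (forall A B, Phi A -> Phi B -> Phi (fun x => A x \/ B x)) ->
  (forall A B : X -> Prop, (forall x, A x -> B x) -> Phi B -> Phi A) ->
  (forall x, exists U, is_open U /\ U x /\ Phi U) -> Phi full.
Proof.
  intros K P0 PU Psub loc.
  destruct (K (fun U => is_open U /\ Phi U)) as (l & Hl & cov).
  - tauto.
  - intros x _. destruct (loc x) as (U & oU & Ux & PhiU). exists U. tauto.
  - apply Psub with (B := fun x => exists U, In U l /\ U x); auto.
    clear cov. induction l as [ | U l IH].
    + apply Psub with (B := fun _ => False); auto. intros x (U & [] & _).
    + apply Psub with (B := fun x => U x \/ exists W, In W l /\ W x).
      * intros x (W & [-> | HW] & Wx); eauto.
      * apply PU; [apply Hl; left; auto | apply IH]. intros W HW. apply Hl. right. auto.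
Qed.

Lemma compact_uniform (Phi : R -> X -> Prop) :
  compact_set (@full X) ->
  (forall c c' x, 0 < c' <= c -> Phi c x -> Phi c' x) ->
  (forall x, exists U c, is_open U /\ U x /\ 0 < c /\ forall y, U y -> Phi c y) ->
  exists c, 0 < c /\ forall x, Phi c x.
Proof.
  intros K mono loc.
  destruct (compact_induction (fun U => exists c, 0 < c /\ forall y, U y -> Phi c y) K)
    as (c & c0 & Hc).
  - exists 1. split; [lra | tauto].
  - intros A B (a & a0 & Ha) (b & b0 & Hb). exists (Rmin a b).
    assert (0 < Rmin a b) by (apply Rmin_glb_lt; auto).
    pose proof (Rmin_l a b). pose proof (Rmin_r a b).
    split; auto. intros y [Hy | Hy]; [apply mono with a | apply mono with b]; auto.
  - intros A B AB (c & c0 & Hc). exists c. auto.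
  - intros x. destruct (loc x) as (U & c & oU & Ux & c0 & Hc). exists U. eauto 6.
  - exists c. split; auto. intros x. apply Hc. exact I.
Qed.

(* Connectedness im kleinen at every point already gives local connectedness: the set of points
   joined to [x] inside [U] is then relatively open. *)
Lemma locally_connected_weak (Y : X -> Prop) :
  (forall x U, Y x -> is_open U -> U x ->
     exists S, is_open S /\ S x /\
       forall y, Y y -> S y ->
         exists C, connected_set C /\ C x /\ C y /\ forall z, C z -> Y z /\ U z) ->
  locally_connected_set Y.
Proof.
  intros H x U Yx oU Ux.
  set (Comp := fun y => exists C, connected_set C /\ C x /\ C y /\ forall z, C z -> Y z /\ U z).
  assert (W_comp : forall y,
    (Y y /\ exists S, (is_open S /\ forall z, Y z -> S z -> Comp z) /\ S y) <-> Comp y).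
  { intros y. split.
    - intros (Yy & S & (_ & HS) & Sy). auto.
    - intros (C & cC & Cx & Cy & CYU).
      destruct (CYU y Cy) as (Yy & Uy). split; auto.
      destruct (H y U Yy oU Uy) as (S & oS & Sy & HS).
      exists S. repeat split; auto. intros z Yz Sz.
      destruct (HS z Yz Sz) as (D & cD & Dy & Dz & DYU).
      exists (fun w => C w \/ D w). repeat split; auto.
      + apply (connected_union C D y); auto.
      + destruct H0; [apply CYU | apply DYU]; auto.
      + destruct H0; [apply CYU | apply DYU]; auto. }
  assert (Cx : Comp x).
  { destruct (H x U Yx oU Ux) as (S & oS & Sx & HS). apply (HS x Yx Sx). }
  exists (fun y => exists S, (is_open S /\ forall z, Y z -> S z -> Comp z) /\ S y).
  repeat split.
  - apply open_union. tauto.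
  - apply W_comp, Cx.
  - intros y Yy Wy. assert (Cy : Comp y) by (apply W_comp; auto).
    destruct Cy as (C & _ & _ & Cy & CYU). apply CYU, Cy.
  - rewrite (pred_ext _ _ W_comp). apply (connected_star _ x).
    intros y (C & cC & C1 & Cy & CYU). exists C. repeat split; auto.
    intros z Cz. exists C. auto.
Qed.

(* Boundary bumping. *)
Lemma connected_reach (G N : X -> Prop) y g0 :
  locally_connected_set (@full X) -> is_open (fun x => ~ G x) ->
  is_open N -> connected_set N -> N y -> ~ G y -> N g0 -> G g0 ->
  exists g D, G g /\ N g /\ connected_set D /\ D y /\ closure D g /\
    forall z, D z -> N z /\ ~ G z.
Proof.
  intros lc oG oN cN Ny Gy Ng0 Gg0.
  (* [M] is the component of [y] in [N] minus [G]. It is open by local connectedness; if its closure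
     missed [G] inside [N], it would also be relatively closed and split [N]. *)
  set (M := fun z => exists D, connected_set D /\ D y /\ D z /\ forall w, D w -> N w /\ ~ G w).
  assert (local : forall z, N z -> ~ G z -> exists W, is_open W /\ W z /\
            connected_set W /\ forall w, W w -> N w /\ ~ G w).
  { intros z Nz Gz.
    destruct (connected_nbhd z (fun w => N w /\ ~ G w) lc) as (W & oW & Wz & WN & cW); auto.
    - apply open_inter; auto.
    - exists W. auto. }
  assert (grow : forall z W, M z -> W z -> connected_set W ->
            (forall w, W w -> N w /\ ~ G w) -> forall w, W w -> M w).
  { intros z W (D & cD & Dy & Dz & HD) Wz cW HW w Ww.
    exists (fun u => D u \/ W u). repeat split; auto.
    - apply (connected_union D W z); auto.
    - destruct H; [apply HD | apply HW]; auto.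
    - destruct H; [apply HD | apply HW]; auto. }
  assert (My : M y).
  { destruct (local y Ny Gy) as (W & oW & Wy & cW & HW). exists W. auto. }
  assert (MN : forall z, M z -> N z /\ ~ G z).
  { intros z (D & _ & _ & Dz & HD). auto. }
  assert (cM : connected_set M).
  { apply (connected_star _ y). intros z (D & cD & Dy & Dz & HD).
    exists D. repeat split; auto. intros w Dw. exists D. auto. }
  destruct (classic (exists g, G g /\ N g /\ closure M g)) as [(g & Gg & Ng & Mg) | no].
  { exists g, M. repeat split; auto; apply MN; auto. }
  exfalso. apply cN.
  exists M, (fun z => N z /\ ~ M z). repeat split.
  - apply open_local. intros z Mz. destruct (MN z Mz) as (Nz & Gz).
    destruct (local z Nz Gz) as (W & oW & Wz & cW & HW). exists W. repeat split; auto.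
    apply (grow z W); auto.
  - apply open_local. intros z (Nz & Mz).
    destruct (classic (G z)) as [Gz | Gz].
    + destruct (not_closure_nbhd M z) as (W & oW & Wz & HW).
      { intros Hz. apply no. exists z. auto. }
      exists (fun w => N w /\ W w). repeat split; auto.
      * apply open_inter; auto.
      * apply H.
      * apply HW, H.
    + destruct (local z Nz Gz) as (W & oW & Wz & cW & HW). exists W. repeat split; auto.
      * apply HW; auto.
      * intros Hy. apply Mz. apply (grow y0 W); auto.
  - intros z Nz. destruct (classic (M z)); auto.
  - exists y. auto.
  - exists g0. repeat split; auto. intros Hg0. apply (MN g0 Hg0), Gg0.
  - tauto.
Qed.

End Topology.

(** * Metric tools and sequences by dependent choice *)

Definition metrizes (X : TopSpace) (d : X -> X -> R) : Prop :=
  is_metric_on X full d /\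
  forall U : X -> Prop,
    is_open U <-> forall x, U x -> exists eps, 0 < eps /\ forall y, d x y < eps -> U y.

Lemma metrizable_metrizes (X : TopSpace) :
  metrizable_set (@full X) -> exists d, metrizes X d.
Proof.
  intros (d & Hd & top). exists d. split; auto. intros U.
  destruct (top U) as [H1 H2]; [intros; exact I | ]. split.
  - intros oU x Ux. destruct H1 with x as (eps & e0 & He); auto.
    + exists U. split; auto. unfold full. tauto.
    + exists eps. split; auto. intros y. apply He. exact I.
  - intros H. destruct H2 as (W & oW & HW).
    + intros x Ux. destruct (H x Ux) as (eps & e0 & He). exists eps. auto.
    + replace U with W; auto. apply pred_ext. intros x. rewrite HW. unfold full. tauto.
Qed.

Section Metric.
Context {X : TopSpace} (d : X -> X -> R) (Hd : metrizes X d).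

Lemma metric_pos x y : 0 <= d x y.
Proof. apply Hd; exact I. Qed.

Lemma metric_refl x : d x x = 0.
Proof. apply Hd; auto; exact I. Qed.

Lemma metric_eq x y : d x y = 0 -> x = y.
Proof. apply Hd; exact I. Qed.

Lemma metric_sym x y : d x y = d y x.
Proof. apply Hd; exact I. Qed.

Lemma metric_tri x y z : d x z <= d x y + d y z.
Proof. apply Hd; exact I. Qed.

Lemma open_ball_in U x :
  is_open U -> U x -> exists eps, 0 < eps /\ forall y, d x y < eps -> U y.
Proof. intros oU. apply (proj1 (proj2 Hd U) oU). Qed.

Lemma ball_open x r : is_open (fun y => d x y < r).
Proof.
  apply (proj2 Hd). intros y Hy. exists (r - d x y). split; [lra | ].
  intros z Hz. pose proof (metric_tri x y z). lra.
Qed.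

Lemma coball_open x r : is_open (fun y => r < d x y).
Proof.
  apply (proj2 Hd). intros y Hy. exists (d x y - r). split; [lra | ].
  intros z Hz. pose proof (metric_tri x z y). rewrite (metric_sym z y) in H. lra.
Qed.

Lemma separate x y :
  x <> y -> exists U W : X -> Prop,
    is_open U /\ is_open W /\ U x /\ W y /\ forall z, U z -> W z -> False.
Proof.
  intros ne. assert (0 < d x y).
  { destruct (metric_pos x y) as [ | e]; auto. exfalso. apply ne, metric_eq. auto. }
  exists (fun z => d x z < d x y / 2), (fun z => d y z < d x y / 2).
  repeat split; try apply ball_open; try (rewrite metric_refl; lra).
  intros z H1 H2. pose proof (metric_tri x z y). rewrite (metric_sym z y) in H0. lra.
Qed.

Lemma open_neq x : is_open (fun y : X => y <> x).
Proof.
  apply open_local. intros y ne. destruct (separate y x ne) as (U & W & oU & oW & Uy & Wx & dis).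
  exists U. repeat split; auto. intros z Uz ->. eauto.
Qed.

Lemma closure_ball_le (A : X -> Prop) x r g :
  (forall y, A y -> d x y < r) -> closure A g -> d x g <= r.
Proof.
  intros HA Hg. destruct (Rle_or_lt (d x g) r) as [ | lt]; auto.
  destruct (Hg _ (coball_open x r) lt) as (y & Hy & Ay). specialize (HA y Ay). lra.
Qed.

(** A Lebesgue number for the cover by open sets on whose squares [T] holds. *)
Lemma lebesgue (T : X -> X -> Prop) :
  compact_set (@full X) ->
  (forall x, exists U, is_open U /\ U x /\ forall y z, U y -> U z -> T y z) ->
  exists c, 0 < c /\ forall y z, d y z < c -> T y z.
Proof.
  intros K loc.
  destruct (compact_uniform (fun c y => forall z, d y z < c -> T y z) K) as (c & c0 & Hc).
  - intros c c' x Hc H z Hz. apply H. lra.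
  - intros x. destruct (loc x) as (U & oU & Ux & HU).
    destruct (open_ball_in U x oU Ux) as (eps & e0 & He).
    exists (fun y => d x y < eps / 2), (eps / 2). repeat split.
    + apply ball_open.
    + rewrite metric_refl. lra.
    + lra.
    + intros y Hy z Hz. apply HU; apply He; [lra | ]. pose proof (metric_tri x y z). lra.
  - exists c. split; auto.
Qed.

(** If removing [a] emptied a nonempty open set, [{a}] would be clopen in a connected space with two
    points. Applied to [P], this lets finite nets dodge one another. *)
Lemma open_avoids_list (p0 q0 : X) (l : list X) :
  connected_set (@full X) -> p0 <> q0 ->
  forall O : X -> Prop, is_open O -> (exists p, O p) -> exists q, O q /\ ~ In q l.
Proof.
  intros cX ne. induction l as [ | a l IH]; intros O oO (p & Op).
  - exists p. auto.
  - destruct (IH (fun q => O q /\ q <> a)) as (q & (Oq & qa) & ql).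
    + apply open_inter; auto using open_neq.
    + apply NNPP. intros no.
      assert (Oa : forall q, O q -> q = a).
      { intros q Oq. apply NNPP. intros qa. apply no. exists q. auto. }
      assert (all : forall y, y = a).
      { intros y. apply Oa. apply (connected_clopen O p y); auto.
        apply open_local. intros z Hz. exists (fun w => w <> a).
        split; [apply open_neq | split].
        - intros ->. rewrite (Oa p Op) in Op. auto.
        - auto. }
      apply ne. rewrite (all p0), (all q0). reflexivity.
    + exists q. split; auto. intros [-> | Hl]; auto.
Qed.

End Metric.

Lemma list_uniform {T : Type} (Phi : R -> T -> Prop) (l : list T) :
  (forall c c' x, 0 < c' <= c -> Phi c x -> Phi c' x) ->
  (forall x, In x l -> exists c, 0 < c /\ Phi c x) ->
  exists c, 0 < c /\ forall x, In x l -> Phi c x.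
Proof.
  intros mono. induction l as [ | a l IH]; intros H.
  - exists 1. split; [lra | intros x []].
  - destruct IH as (c & c0 & Hc). { intros x Hx. apply H. right. auto. }
    destruct (H a) as (b & b0 & Hb). { left. auto. }
    exists (Rmin b c). assert (0 < Rmin b c) by (apply Rmin_glb_lt; auto).
    pose proof (Rmin_l b c). pose proof (Rmin_r b c). split; auto.
    intros x [<- | Hx]; [apply mono with b | apply mono with c]; auto.
Qed.

Lemma dependent_sequence {T : Type} (I : nat -> T -> Prop) (Q : nat -> T -> T -> Prop) :
  (exists x, I 0%nat x) ->
  (forall n x, I n x -> exists y, I (S n) y /\ Q n x y) ->
  exists f : nat -> T, forall n, I n (f n) /\ Q n (f n) (f (S n)).
Proof.
  intros H0 H.
  destruct (constructive_indefinite_description _ H0) as (x0 & Ix0).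
  pose (next := fun n x => epsilon (inhabits x0) (fun y => I (S n) y /\ Q n x y)).
  pose (f := fix f n := match n with O => x0 | S k => next k (f k) end).
  assert (If : forall n, I n (f n)).
  { induction n as [ | n IH]; [exact Ix0 | ].
    simpl. unfold next. apply (epsilon_spec (inhabits x0) _ (H n (f n) IH)). }
  exists f. intros n. split; [apply If | ].
  apply (epsilon_spec (inhabits x0) _ (H n (f n) (If n))).
Qed.

(** * Arcs and the ends of edges *)

(** The body of [homeo_open_interval] with the parametrization exposed; the two are convertible, so
    [change] brings a witness into this form. *)
Definition arc_param (X : TopSpace) (A : X -> Prop) (h : R -> X) : Prop :=
  (forall x, A x <-> exists t, 0 < t < 1 /\ h t = x) /\
  (forall s t, 0 < s < 1 -> 0 < t < 1 -> h s = h t -> s = t) /\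
  (forall t U, 0 < t < 1 -> is_open U -> U (h t) ->
     exists delta, 0 < delta /\
       forall s, 0 < s < 1 -> Rabs (s - t) < delta -> U (h s)) /\
  (forall t eps, 0 < t < 1 -> 0 < eps ->
     exists U, is_open U /\ U (h t) /\
       forall s, 0 < s < 1 -> U (h s) -> Rabs (s - t) < eps).
Arguments arc_param {X} A h.

Definition seg {X : TopSpace} (h : R -> X) (a b : R) : X -> Prop :=
  fun x => exists t, a < t < b /\ h t = x.

(** Only the end at 0 is treated; the end at 1 is the end at 0 of [fun t => h (1 - t)]. *)
Definition end_limit {X : TopSpace} (h : R -> X) (a : X) : Prop :=
  forall U, is_open U -> U a -> exists t0, 0 < t0 < 1 /\ forall t, 0 < t < t0 -> U (h t).

Lemma seg_reverse {X : TopSpace} (h : R -> X) a b :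
  seg (fun t => h (1 - t)) a b = seg h (1 - b) (1 - a).
Proof.
  apply pred_ext. intros x. split; intros (t & Ht & <-); exists (1 - t); (split; [lra | ]); auto.
  f_equal. lra.
Qed.

Section Arc.
Context {X : TopSpace} (d : X -> X -> R) (Hd : metrizes X d).

Lemma arc_reverse (A : X -> Prop) h : arc_param A h -> arc_param A (fun t => h (1 - t)).
Proof.
  intros (im & inj & cont & inv). repeat split.
  - intros Ax. apply im in Ax. destruct Ax as (t & Ht & <-). exists (1 - t). split; [lra | ].
    f_equal. lra.
  - intros (t & Ht & <-). apply im. exists (1 - t). split; [lra | auto].
  - intros s t Hs Ht e. apply inj in e; lra.
  - intros t U Ht oU Ut. destruct (cont (1 - t) U) as (delta & d0 & Hdel); auto; [lra | ].
    exists delta. split; auto. intros s Hs Hst. apply Hdel; [lra | ].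
    replace (1 - s - (1 - t)) with (- (s - t)) by lra. rewrite Rabs_Ropp. auto.
  - intros t eps Ht e0. destruct (inv (1 - t) eps) as (U & oU & Ut & HU); auto; [lra | ].
    exists U. repeat split; auto. intros s Hs Us.
    replace (s - t) with (- (1 - s - (1 - t))) by lra. rewrite Rabs_Ropp. apply HU; auto. lra.
Qed.

Section Param.
Variables (A : X -> Prop) (h : R -> X).
Hypotheses (oA : is_open A) (Hh : arc_param A h).

Lemma arc_in t : 0 < t < 1 -> A (h t).
Proof. intros Ht. apply Hh. exists t. auto. Qed.

Lemma arc_inj s t : 0 < s < 1 -> 0 < t < 1 -> h s = h t -> s = t.
Proof. apply Hh. Qed.

Lemma arc_continuous a b t (U : X -> Prop) :
  0 <= a -> b <= 1 -> a < t < b -> is_open U -> U (h t) ->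
  exists delta, 0 < delta /\ forall s, Rabs (s - t) < delta -> a < s < b /\ U (h s).
Proof.
  intros Ha Hb Ht oU Ut. destruct Hh as (_ & _ & cont & _).
  destruct (cont t U) as (delta & d0 & Hdel); auto; [lra | ].
  set (m := Rmin (t - a) (b - t)).
  assert (m0 : 0 < m) by (apply Rmin_glb_lt; lra).
  pose proof (Rmin_l (t - a) (b - t)). pose proof (Rmin_r (t - a) (b - t)). fold m in H, H0.
  exists (Rmin delta m). pose proof (Rmin_l delta m). pose proof (Rmin_r delta m).
  split; [apply Rmin_glb_lt; auto | ]. intros s Hs.
  assert (a < s < b).
  { assert (Rabs (s - t) < m) by lra. apply Rabs_def2 in H3. lra. }
  split; auto. apply Hdel; lra.
Qed.

Lemma seg_open a b : 0 <= a -> b <= 1 -> is_open (seg h a b).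
Proof.
  intros Ha Hb. apply open_local. intros x (t & Ht & <-).
  destruct Hh as (im & inj & cont & inv).
  set (m := Rmin (t - a) (b - t)).
  assert (m0 : 0 < m) by (apply Rmin_glb_lt; lra).
  pose proof (Rmin_l (t - a) (b - t)). pose proof (Rmin_r (t - a) (b - t)). fold m in H, H0.
  destruct (inv t m) as (U & oU & Ut & HU); auto; [lra | ].
  exists (fun x => U x /\ A x). split; [apply open_inter; auto | ]. split.
  - split; auto. apply arc_in. lra.
  - intros y (Uy & Ay). apply im in Ay. destruct Ay as (s & Hs & <-).
    specialize (HU s Hs Uy). apply Rabs_def2 in HU. exists s. split; auto. lra.
Qed.

Lemma seg_connected a b : 0 <= a -> b <= 1 -> connected_set (seg h a b).
Proof.
  intros Ha Hb.
  assert (key : forall (U V : X -> Prop) t1 t2, is_open U -> is_open V ->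
    (forall z, seg h a b z -> U z \/ V z) -> (forall z, seg h a b z -> U z -> V z -> False) ->
    a < t1 -> t1 < t2 -> t2 < b -> U (h t1) -> V (h t2) -> False).
  { intros U V t1 t2 oU oV cov dis H1 H12 H2 Ut Vt.
    (* A separation of the image would make this two-valued function continuous, against the
       intermediate value theorem. *)
    set (f := fun t => if excluded_middle_informative (U (h t)) then -1 else 1).
    destruct (IVT_interv f t1 t2) as (t & Ht & ft).
    - intros t Ht eps e0.
      assert (in_seg : forall s, a < s < b -> seg h a b (h s)).
      { intros s Hs. exists s. auto. }
      assert (E : exists delta, 0 < delta /\ forall s, Rabs (s - t) < delta -> f s = f t).
      { assert (It : a < t < b) by lra.
        unfold f. destruct (excluded_middle_informative (U (h t))) as [Uht | Uht].
        - destruct (arc_continuous a b t U) as (delta & d0 & Hdel); auto.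
          exists delta. split; auto. intros s Hs.
          destruct (excluded_middle_informative (U (h s))) as [ | no]; auto.
          exfalso. apply no, Hdel, Hs.
        - destruct (arc_continuous a b t V) as (delta & d0 & Hdel); auto.
          { destruct (cov (h t)); auto. tauto. }
          exists delta. split; auto. intros s Hs.
          destruct (excluded_middle_informative (U (h s))) as [yes | ]; auto.
          exfalso. destruct (Hdel s Hs). eauto. }
      destruct E as (delta & d0 & E). exists delta. split; auto.
      intros s (_ & Hs). simpl in *. unfold Rdist in *. rewrite E; auto.
      replace (f t - f t) with 0 by lra. rewrite Rabs_R0. auto.
    - auto.
    - unfold f. destruct (excluded_middle_informative (U (h t1))); [lra | tauto].
    - unfold f. destruct (excluded_middle_informative (U (h t2))); [ | lra].
      exfalso. apply (dis (h t2)); auto. exists t2. split; auto. lra.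
    - unfold f in ft. destruct (excluded_middle_informative (U (h t))); lra. }
  apply connected_intro. intros U V x y oU oV cov dis (t1 & H1 & <-) Ux (t2 & H2 & <-) Vy.
  destruct (Rtotal_order t1 t2) as [lt | [-> | gt]].
  - apply (key U V t1 t2); auto; lra.
  - apply (dis (h t2)); auto. exists t2. auto.
  - apply (key V U t2 t1); auto; try lra.
    + intros z Hz. destruct (cov z Hz); auto.
    + intros z Hz Vz Uz. apply (dis z); auto.
Qed.

Lemma arc_eq_seg : A = seg h 0 1.
Proof. apply pred_ext. intros x. apply Hh. Qed.

Lemma arc_connected : connected_set A.
Proof. rewrite arc_eq_seg. apply seg_connected; lra. Qed.

(** The distance from [z] to the compact subarc is attained, hence positive. *)
Lemma closed_seg a b z :
  0 < a -> a <= b -> b < 1 -> (forall t, a <= t <= b -> h t <> z) ->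
  exists U, is_open U /\ U z /\ forall t, a <= t <= b -> ~ U (h t).
Proof.
  intros Ha Hab Hb Hz.
  destruct (continuity_ab_min (fun t => d z (h t)) a b Hab) as (m & Hm & mab).
  - intros t Ht eps e0.
    destruct (arc_continuous 0 1 t (fun y => d (h t) y < eps)) as (delta & d0 & Hdel);
      try lra; try apply (ball_open d Hd).
    { rewrite (metric_refl d Hd). auto. }
    exists delta. split; auto. intros s (_ & Hs). simpl in *. unfold Rdist in *.
    destruct (Hdel s Hs) as (_ & Hts).
    pose proof (metric_tri d Hd z (h t) (h s)). pose proof (metric_tri d Hd z (h s) (h t)).
    rewrite (metric_sym d Hd (h s) (h t)) in H0. apply Rabs_def1; lra.
  - assert (0 < d z (h m)).
    { destruct (metric_pos d Hd z (h m)) as [ | e]; auto. exfalso. apply (Hz m mab).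
      symmetry. apply (metric_eq d Hd). auto. }
    exists (fun y => d z y < d z (h m)). repeat split.
    + apply (ball_open d Hd).
    + rewrite (metric_refl d Hd). auto.
    + intros t Ht Hlt. specialize (Hm t Ht). simpl in Hm. lra.
Qed.

(** By continuity of the inverse, points of the arc near [h s] have parameters near [s], hence away
    from 0. *)
Lemma cluster_not_in a :
  (forall U, is_open U -> U a -> forall t0, 0 < t0 -> exists t, 0 < t < t0 /\ t < 1 /\ U (h t)) ->
  ~ A a.
Proof.
  intros Ha Aa. destruct Hh as (im & inj & cont & inv).
  apply im in Aa. destruct Aa as (s & Hs & <-).
  destruct (inv s (s / 2)) as (U & oU & Us & HU); auto; [lra | ].
  destruct (Ha U oU Us (s / 2)) as (t & Ht & t1 & Ut); [lra | ].
  assert (Rabs (t - s) < s / 2) by (apply HU; auto; lra).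
  apply Rabs_def2 in H. lra.
Qed.

Lemma end_limit_not_in a : end_limit h a -> ~ A a.
Proof.
  intros Ha. apply cluster_not_in. intros U oU Ua t0 H0.
  destruct (Ha U oU Ua) as (t1 & H1 & Ht). exists (Rmin t0 t1 / 2).
  assert (0 < Rmin t0 t1) by (apply Rmin_glb_lt; lra).
  pose proof (Rmin_l t0 t1). pose proof (Rmin_r t0 t1).
  repeat split; try lra. apply Ht. lra.
Qed.

(* A connected neighbourhood of a cluster point of the end that kept being left would be split
   by a compact subarc with both end points outside it. *)
Lemma end_limit_exists :
  compact_set (@full X) -> locally_connected_set (@full X) -> exists a, end_limit h a.
Proof.
  intros K lc.
  destruct (classic (exists a, forall U, is_open U -> U a -> forall t0, 0 < t0 ->
    exists t, 0 < t < t0 /\ t < 1 /\ U (h t))) as [(a & Ha) | no].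
  - exists a. intros U oU Ua.
    pose proof (cluster_not_in a Ha) as Aa.
    destruct (connected_nbhd a U lc oU Ua) as (N & oN & Na & NU & cN).
    apply NNPP. intros bad.
    assert (out : forall t0, 0 < t0 < 1 -> exists t, 0 < t < t0 /\ ~ N (h t)).
    { intros t0 H0. apply NNPP. intros no. apply bad. exists t0. split; auto.
      intros t Ht. apply NU. apply NNPP. intros Nt. apply no. exists t. auto. }
    destruct (out (1 / 2)) as (t2 & H2 & N2); [lra | ].
    destruct (Ha N oN Na t2) as (t3 & H3 & _ & N3); [lra | ].
    destruct (out t3) as (t4 & H4 & N4); [lra | ].
    apply cN. exists (seg h t4 t2), (fun z => forall t, t4 <= t <= t2 -> h t <> z).
    split; [apply seg_open; lra | ]. split; [ | split; [ | split; [ | split]]].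
    + apply open_local. intros z Hz.
      destruct (closed_seg t4 t2 z) as (W & oW & Wz & HW); auto; try lra.
      exists W. repeat split; auto. intros y Wy t Ht <-. eapply HW; eauto.
    + intros z Nz. destruct (classic (seg h t4 t2 z)) as [ | Hz]; auto.
      right. intros t Ht <-. apply Hz. exists t. split; auto.
      destruct (Req_dec t t4) as [-> | ]; [tauto | ].
      destruct (Req_dec t t2) as [-> | ]; [tauto | lra].
    + exists (h t3). split; auto. exists t3. auto. split; auto; lra.
    + exists a. split; auto. intros t Ht <-. apply Aa, arc_in. lra.
    + intros z Nz (t & Ht & <-) Hz. apply (Hz t); auto. lra.
  - exfalso.
    destruct (compact_uniform (fun c x => forall t, 0 < t < c -> t < 1 -> h t <> x) K)
      as (c & c0 & Hc).
    + intros c c' x Hc H t Ht. apply H. lra.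
    + intros x. apply not_all_not_ex. intros bad. apply no. exists x.
      intros U oU Ux t0 H0. apply NNPP. intros none. apply (bad U). exists t0.
      repeat split; auto. intros y Uy t Ht t1 <-. apply none. exists t. auto.
    + pose proof (Rmin_l c 1). pose proof (Rmin_r c 1).
      assert (0 < Rmin c 1) by (apply Rmin_glb_lt; lra).
      apply (Hc (h (Rmin c 1 / 2)) (Rmin c 1 / 2)); auto; lra.
Qed.

(** Apart from a start that is close to [a], the segment lies in a compact subarc, which is
    closed. *)
Lemma initial_seg_closure a t z :
  end_limit h a -> 0 < t < 1 -> closure (seg h 0 t) z -> A z \/ z = a.
Proof.
  intros Ha Ht Hz. apply NNPP. intros no. apply not_or_and in no. destruct no as (Az & za).
  destruct (separate d Hd z a za) as (U & W & oU & oW & Uz & Wa & dis).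
  destruct (Ha W oW Wa) as (t0 & H0 & HW).
  set (m := Rmin t0 t / 2).
  assert (0 < Rmin t0 t) by (apply Rmin_glb_lt; lra).
  pose proof (Rmin_l t0 t). pose proof (Rmin_r t0 t).
  destruct (closed_seg m t z) as (U' & oU' & Uz' & HU'); unfold m; try lra.
  { intros s Hs <-. apply Az, arc_in. lra. }
  destruct (Hz (fun y => U y /\ U' y)) as (y & (Uy & Uy') & s & Hs & <-); auto.
  { apply open_inter; auto. }
  destruct (Rlt_or_le s t0) as [lt | le].
  - apply (dis (h s)); auto. apply HW. lra.
  - apply (HU' s); auto. unfold m in *. lra.
Qed.

End Param.

Lemma final_seg_closure (A : X -> Prop) h b t z :
  is_open A -> arc_param A h ->
  end_limit (fun t => h (1 - t)) b -> 0 < t < 1 -> closure (seg h t 1) z -> A z \/ z = b.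
Proof.
  intros oA Hh Hb Ht Hz.
  apply (initial_seg_closure A _ (arc_reverse A h Hh) b (1 - t) z); auto; [lra | ].
  rewrite seg_reverse. replace (1 - (1 - t)) with t by lra. replace (1 - 0) with 1 by lra. auto.
Qed.

Lemma arc_closure (A : X -> Prop) h a b z :
  is_open A -> arc_param A h -> end_limit h a -> end_limit (fun t => h (1 - t)) b ->
  closure A z -> A z \/ z = a \/ z = b.
Proof.
  intros oA Hh Ha Hb Hz.
  (* The two segments overlap, so a point outside the closure of the first has a neighbourhood that
     meets the arc only in the second. *)
  destruct (classic (closure (seg h 0 (2 / 3)) z)) as [H | H].
  - destruct (initial_seg_closure A h Hh a (2 / 3) z); auto. lra.
  - destruct (final_seg_closure A h b (1 / 3) z); auto; [lra | ].
    destruct (not_closure_nbhd _ _ H) as (U & oU & Uz & HU).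
    intros W oW Wz. destruct (Hz (fun y => U y /\ W y)) as (y & (Uy & Wy) & Ay); auto.
    { apply open_inter; auto. }
    exists y. split; auto. apply Hh in Ay. destruct Ay as (t & Ht & <-).
    destruct (Rlt_or_le t (2 / 3)).
    + exfalso. apply (HU (h t)); auto. exists t. split; auto. lra.
    + exists t. split; auto. lra.
Qed.

(** If [h t] were missing from [D], then [D] would lie on one side of it, and the closure of that
    side has at most one point outside [A]. *)
Lemma connected_two_ends (A D : X -> Prop) h a b g g' :
  is_open A -> arc_param A h -> end_limit h a -> end_limit (fun t => h (1 - t)) b ->
  connected_set D -> (forall x, D x -> A x) ->
  closure D g -> ~ A g -> closure D g' -> ~ A g' -> g <> g' ->
  forall x, A x -> D x.
Proof.
  intros oA Hh Ha Hb cD DA Hg Ag Hg' Ag' ne x Ax.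
  apply NNPP. intros Dx. apply Hh in Ax. destruct Ax as (t & Ht & <-).
  assert (cov : forall z, D z -> seg h 0 t z \/ seg h t 1 z).
  { intros z Dz. pose proof (DA z Dz) as Az. apply Hh in Az. destruct Az as (s & Hs & <-).
    destruct (Rtotal_order s t) as [lt | [-> | gt]]; [left | tauto | right];
      exists s; split; auto; lra. }
  assert (dis : forall z, D z -> seg h 0 t z -> seg h t 1 z -> False).
  { intros z _ (s & Hs & <-) (u & Hu & e). apply (arc_inj A h Hh) in e; lra. }
  assert (o1 : is_open (seg h 0 t)) by (apply (seg_open A); auto; lra).
  assert (o2 : is_open (seg h t 1)) by (apply (seg_open A); auto; lra).
  destruct (classic (forall z, D z -> seg h 0 t z)) as [all | some].
  - assert (forall k, closure D k -> ~ A k -> k = a).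
    { intros k Hk Ak. destruct (initial_seg_closure A h Hh a t k); auto; try tauto.
      apply (closure_incl D); auto. }
    apply ne. transitivity a; [ | symmetry]; auto.
  - assert (all : forall z, D z -> seg h t 1 z).
    { apply not_all_ex_not in some. destruct some as (y & Hy). apply imply_to_and in Hy.
      destruct Hy as (Dy & Hy). intros z Dz.
      apply (connected_side D (seg h t 1) (seg h 0 t) y z); auto.
      - intros w Dw. destruct (cov w Dw); auto.
      - intros w Dw H1 H2. apply (dis w); auto.
      - destruct (cov y Dy); tauto. }
    assert (forall k, closure D k -> ~ A k -> k = b).
    { intros k Hk Ak. destruct (final_seg_closure A h b t k); auto; try tauto.
      apply (closure_incl D); auto. }
    apply ne. transitivity b; [ | symmetry]; auto.
Qed.

End Arc.

(** Lets a glued arc be recognized by open images of intervals instead of estimates for its inverse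
    at the seam. *)
Lemma arc_param_of_open {X : TopSpace} (B : X -> Prop) (k : R -> X) :
  (forall x, B x <-> exists t, 0 < t < 1 /\ k t = x) ->
  (forall s t, 0 < s < 1 -> 0 < t < 1 -> k s = k t -> s = t) ->
  (forall t U, 0 < t < 1 -> is_open U -> U (k t) ->
     exists delta, 0 < delta /\ forall s, 0 < s < 1 -> Rabs (s - t) < delta -> U (k s)) ->
  (forall a b, 0 <= a -> b <= 1 -> is_open (seg k a b)) ->
  arc_param B k.
Proof.
  intros im inj cont op. repeat split; try apply im; auto.
  intros t eps Ht e0.
  pose proof (Rmax_l 0 (t - eps)). pose proof (Rmax_r 0 (t - eps)).
  pose proof (Rmin_l 1 (t + eps)). pose proof (Rmin_r 1 (t + eps)).
  exists (seg k (Rmax 0 (t - eps)) (Rmin 1 (t + eps))). split; [apply op; auto | ]. split.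
  - exists t. split; auto. split; [apply Rmax_lub_lt | apply Rmin_glb_lt]; lra.
  - intros s Hs (u & Hu & e). apply inj in e; [ | lra | lra]. subst u. apply Rabs_def1; lra.
Qed.

(** * Ends of edges are ground points *)

Section Ends.
Context {X : TopSpace} (d : X -> X -> R) (Hd : metrizes X d).

(** The start of [h] is connected, contains some [h' s1] and accumulates at [h' s], so it passes
    through every point of [h'] between the two. *)
Lemma end_covers_right (A A' : X -> Prop) h h' s t0 :
  is_open A -> arc_param A h -> is_open A' -> arc_param A' h' ->
  0 < s < 1 -> end_limit h (h' s) -> 0 < t0 < 1 ->
  (forall x, seg h 0 t0 x -> seg h' s 1 x) ->
  forall tau, 0 < tau < 1 ->
    exists rho, s < rho <= 1 /\ forall x, seg h' s rho x -> seg h 0 tau x.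
Proof.
  intros oA Hh oA' Hh' Hs Ha H0 sub tau Htau.
  set (m := Rmin tau t0). assert (0 < m) by (apply Rmin_glb_lt; lra).
  pose proof (Rmin_l tau t0). pose proof (Rmin_r tau t0). fold m in H1, H2.
  destruct (sub (h (m / 2))) as (s1 & Hs1 & e1). { exists (m / 2). split; auto. lra. }
  exists s1. split; [lra | ]. intros x (s2 & Hs2 & <-). apply NNPP. intros no.
  assert (all : forall y, seg h 0 m y -> seg h' s2 1 y).
  { intros y Hy. apply (connected_side (seg h 0 m) (seg h' s2 1) (seg h' s s2) (h (m / 2)) y); auto.
    - apply (seg_connected A); auto; lra.
    - apply (seg_open A'); auto; lra.
    - apply (seg_open A'); auto; lra.
    - intros z (t & Ht & <-). destruct (sub (h t)) as (u & Hu & e).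
      { exists t. split; auto. lra. }
      destruct (Rtotal_order u s2) as [lt | [-> | gt]].
      + right. exists u. split; auto. lra.
      + exfalso. apply no. exists t. split; auto. lra.
      + left. exists u. split; auto. lra.
    - intros z _ (u & Hu & <-) (v & Hv & e). apply (arc_inj A' h' Hh') in e; lra.
    - exists (m / 2). split; auto. lra.
    - exists s1. split; auto. lra. }
  destruct (Ha (seg h' 0 s2)) as (t2 & Ht2 & near).
  { apply (seg_open A'); auto; lra. }
  { exists s. split; auto. lra. }
  set (t := Rmin t2 m / 2). assert (0 < Rmin t2 m) by (apply Rmin_glb_lt; lra).
  pose proof (Rmin_l t2 m). pose proof (Rmin_r t2 m).
  destruct (near t) as (u & Hu & eu). { unfold t. lra. }
  destruct (all (h t)) as (v & Hv & ev). { exists t. split; auto. unfold t. lra. }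
  rewrite <- ev in eu. apply (arc_inj A' h' Hh') in eu; lra.
Qed.

(** Near its end [h] runs inside [A'] without meeting [h' s], and a connected set cannot jump over
    that point. *)
Lemma end_side (A A' : X -> Prop) h h' s :
  is_open A -> arc_param A h -> is_open A' -> arc_param A' h' ->
  0 < s < 1 -> end_limit h (h' s) ->
  exists t0, 0 < t0 < 1 /\
    ((forall x, seg h 0 t0 x -> seg h' s 1 x) \/ (forall x, seg h 0 t0 x -> seg h' 0 s x)).
Proof.
  intros oA Hh oA' Hh' Hs Ha.
  destruct (Ha A' oA') as (t0 & Ht0 & near). { apply (arc_in A' h' Hh'); auto. }
  exists t0. split; auto.
  assert (cov : forall x, seg h 0 t0 x -> seg h' s 1 x \/ seg h' 0 s x).
  { intros x (t & Ht & <-). pose proof (near t Ht) as At. apply Hh' in At.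
    destruct At as (u & Hu & e). destruct (Rtotal_order u s) as [lt | [-> | gt]].
    - right. exists u. split; auto. lra.
    - exfalso. apply (end_limit_not_in A h Hh (h' s) Ha). rewrite e.
      apply (arc_in A h Hh). lra.
    - left. exists u. split; auto. lra. }
  destruct (classic (exists x, seg h 0 t0 x /\ seg h' s 1 x)) as [(x & Hx & Hx') | no].
  - left. intros y Hy. apply (connected_side (seg h 0 t0) (seg h' s 1) (seg h' 0 s) x y); auto.
    + apply (seg_connected A); auto; lra.
    + apply (seg_open A'); auto; lra.
    + apply (seg_open A'); auto; lra.
    + intros z _ (u & Hu & <-) (v & Hv & e). apply (arc_inj A' h' Hh') in e; lra.
  - right. intros x Hx. destruct (cov x Hx); auto. exfalso. eauto.
Qed.

(** Prolongs [A] beyond its end by the piece of [h'] from [r] to [s]. The hypothesis on [tau] makes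
    the union open at the seam [h' s]: just right of it, [h'] is already covered by the start of
    [h]. *)
Lemma glue_arcs (A A' : X -> Prop) h h' s r :
  is_open A -> arc_param A h -> is_open A' -> arc_param A' h' ->
  0 < s < 1 -> end_limit h (h' s) -> 0 < r < s ->
  (forall x, seg h' r s x -> ~ A x) ->
  (forall tau, 0 < tau < 1 ->
     exists rho, s < rho <= 1 /\ forall x, seg h' s rho x -> seg h 0 tau x) ->
  exists B, is_open B /\ homeo_open_interval X B /\ (forall x, A x -> B x) /\ B (h' s).
Proof.
  intros oA Hh oA' Hh' Hs Ha Hr dis cover.
  pose proof (end_limit_not_in A h Hh (h' s) Ha) as Aa.
  set (w := s - r). assert (Hw : 0 < w < 1) by (unfold w; lra).
  set (k := fun t => if Rle_dec t (1 / 2) then h' (r + w * (2 * t)) else h (2 * t - 1)).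
  assert (k_left : forall t, t <= 1 / 2 -> k t = h' (r + w * (2 * t))).
  { intros t Ht. unfold k. destruct (Rle_dec t (1 / 2)); auto. lra. }
  assert (k_right : forall t, 1 / 2 < t -> k t = h (2 * t - 1)).
  { intros t Ht. unfold k. destruct (Rle_dec t (1 / 2)); auto. lra. }
  assert (range : forall t, 0 < t <= 1 / 2 -> r < r + w * (2 * t) <= s).
  { intros t Ht. unfold w in *. nra. }
  assert (range_lt : forall t, 0 < t < 1 / 2 -> r < r + w * (2 * t) < s).
  { intros t Ht. unfold w in *. nra. }
  assert (left_inv : forall u, r < u -> exists t, 0 < t /\ u = r + w * (2 * t)).
  { intros u Hu. exists ((u - r) / (2 * w)). split.
    - apply Rdiv_lt_0_compat; lra.
    - field. lra. }
  assert (k_half : k (1 / 2) = h' s).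
  { rewrite k_left; [ | lra]. f_equal. unfold w. lra. }
  assert (left_out : forall t, 0 < t <= 1 / 2 -> ~ A (k t)).
  { intros t Ht. destruct (Req_dec t (1 / 2)) as [-> | ne].
    - rewrite k_half. auto.
    - rewrite k_left; [ | lra]. apply dis. exists (r + w * (2 * t)). split; auto.
      apply range_lt. lra. }
  assert (right_in : forall t, 1 / 2 < t < 1 -> A (k t)).
  { intros t Ht. rewrite k_right; [ | lra]. apply (arc_in A h Hh). lra. }
  set (B := fun x => exists t, 0 < t < 1 /\ k t = x).
  assert (k_arc : forall a b, 0 <= a -> b <= 1 -> is_open (seg k a b)).
  { intros a b H0 H1. apply open_local. intros x (t & Ht & <-).
    destruct (Rtotal_order t (1 / 2)) as [lt | [-> | gt]].
    - pose proof (Rmin_l b (1 / 2)). pose proof (Rmin_r b (1 / 2)).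
      assert (t < Rmin b (1 / 2)) by (apply Rmin_glb_lt; lra).
      exists (seg h' (r + w * (2 * a)) (r + w * (2 * Rmin b (1 / 2)))). repeat split.
      + apply (seg_open A'); auto; unfold w in *; nra.
      + rewrite k_left; [ | lra]. exists (r + w * (2 * t)). split; auto. nra.
      + intros y (u & Hu & <-). destruct (left_inv u) as (v & Hv & ->); [nra | ].
        assert (a < v < Rmin b (1 / 2)) by nra.
        exists v. split; [lra | ]. apply k_left. lra.
    (* At the seam the neighbourhood is a piece of [h'] around [s]; its right part comes from
       [cover]. The parameter is halved because [2 * b - 1] may equal 1. *)
    - destruct (cover ((2 * b - 1) / 2)) as (rho & Hrho & sub); [lra | ].
      exists (seg h' (r + w * (2 * a)) rho). repeat split.
      + apply (seg_open A'); auto; try lra. nra.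
      + rewrite k_half. exists s. split; auto. unfold w in *. nra.
      + intros y (u & Hu & <-). destruct (Rle_or_lt u s) as [le | lt].
        * destruct (left_inv u) as (v & Hv & ->); [nra | ].
          assert (a < v <= 1 / 2) by (unfold w in *; nra).
          exists v. split; [lra | ]. apply k_left. lra.
        * destruct (sub (h' u)) as (v & Hv & <-). { exists u. split; auto. lra. }
          exists ((v + 1) / 2). split; [lra | ]. rewrite k_right; [ | lra]. f_equal. lra.
    - pose proof (Rmax_l (2 * a - 1) 0). pose proof (Rmax_r (2 * a - 1) 0).
      exists (seg h (Rmax (2 * a - 1) 0) (2 * b - 1)). repeat split.
      + apply (seg_open A); auto; lra.
      + rewrite k_right; [ | lra]. exists (2 * t - 1). split; auto.
        split; [apply Rmax_lub_lt | ]; lra.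
      + intros y (u & Hu & <-). exists ((u + 1) / 2). split; [lra | ].
        rewrite k_right; [f_equal | ]; lra. }
  exists B. repeat split.
  - replace B with (seg k 0 1); [apply k_arc; lra | ]. reflexivity.
  - exists k. apply arc_param_of_open; auto.
    + intros x. reflexivity.
    + intros t u Ht Hu e.
      destruct (Rle_or_lt t (1 / 2)) as [Ht' | Ht'], (Rle_or_lt u (1 / 2)) as [Hu' | Hu'].
      * rewrite !k_left in e; auto.
        assert (r < r + w * (2 * t) <= s) by (apply range; lra).
        assert (r < r + w * (2 * u) <= s) by (apply range; lra).
        apply (arc_inj A' h' Hh') in e; [nra | lra | lra].
      * exfalso. apply (left_out t); [lra | ]. rewrite e. apply right_in. lra.
      * exfalso. apply (left_out u); [lra | ]. rewrite <- e. apply right_in. lra.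
      * rewrite !k_right in e; auto. apply (arc_inj A h Hh) in e; lra.
    + intros t U Ht oU Ut.
      assert (left : t <= 1 / 2 -> exists delta, 0 < delta /\
                forall u, 0 < u <= 1 / 2 -> Rabs (u - t) < delta -> U (k u)).
      { intros Ht'. rewrite k_left in Ut; auto.
        assert (r < r + w * (2 * t) <= s) by (apply range; lra).
        destruct (arc_continuous A' h' Hh' 0 1 (r + w * (2 * t)) U)
          as (delta & d0 & Hdel); auto; try lra.
        exists (delta / 2). split; [lra | ]. intros u Hu Hut. rewrite k_left; [ | lra].
        apply Hdel. apply Rabs_def2 in Hut. apply Rabs_def1; nra. }
      assert (right : 1 / 2 <= t -> exists delta, 0 < delta /\
                forall u, 1 / 2 < u < 1 -> Rabs (u - t) < delta -> U (k u)).
      { intros Ht'. destruct (Req_dec t (1 / 2)) as [-> | ne].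
        - rewrite k_half in Ut. destruct (Ha U oU Ut) as (t0 & Ht0 & near).
          exists (t0 / 2). split; [lra | ]. intros u Hu Hut. rewrite k_right; [ | lra].
          apply near. apply Rabs_def2 in Hut. lra.
        - rewrite k_right in Ut; [ | lra].
          destruct (arc_continuous A h Hh 0 1 (2 * t - 1) U) as (delta & d0 & Hdel);
            auto; try lra.
          exists (delta / 2). split; [lra | ]. intros u Hu Hut. rewrite k_right; [ | lra].
          apply Hdel. apply Rabs_def2 in Hut. apply Rabs_def1; lra. }
      destruct (Rtotal_order t (1 / 2)) as [lt | [eq | gt]].
      * destruct left as (delta & d0 & Hdel); [lra | ].
        exists (Rmin delta (1 / 2 - t)). pose proof (Rmin_l delta (1 / 2 - t)).
        pose proof (Rmin_r delta (1 / 2 - t)).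
        split; [apply Rmin_glb_lt; lra | ]. intros u Hu Hut.
        assert (Rabs (u - t) < 1 / 2 - t) by lra. apply Rabs_def2 in H1.
        apply Hdel; lra.
      * destruct left as (delta & d0 & Hdel); [lra | ].
        destruct right as (delta' & d0' & Hdel'); [lra | ].
        exists (Rmin delta delta'). pose proof (Rmin_l delta delta').
        pose proof (Rmin_r delta delta').
        split; [apply Rmin_glb_lt; lra | ]. intros u Hu Hut.
        destruct (Rle_or_lt u (1 / 2)); [apply Hdel | apply Hdel']; lra.
      * destruct right as (delta & d0 & Hdel); [lra | ].
        exists (Rmin delta (t - 1 / 2)). pose proof (Rmin_l delta (t - 1 / 2)).
        pose proof (Rmin_r delta (t - 1 / 2)).
        split; [apply Rmin_glb_lt; lra | ]. intros u Hu Hut.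
        assert (Rabs (u - t) < t - 1 / 2) by lra. apply Rabs_def2 in H1.
        apply Hdel; lra.
  - intros x Ax. apply Hh in Ax. destruct Ax as (t & Ht & <-).
    exists ((t + 1) / 2). split; [lra | ]. rewrite k_right; [f_equal | ]; lra.
  - exists (1 / 2). split; [lra | auto].
Qed.

Hypotheses (K : compact_set (@full X)) (cX : connected_set (@full X))
  (lc : locally_connected_set (@full X)).

Lemma edge_end_right (e A' : X -> Prop) h h' s t0 y0 :
  edge e -> arc_param e h -> is_open A' -> arc_param A' h' ->
  0 < s < 1 -> end_limit h (h' s) -> 0 < t0 < 1 ->
  (forall x, seg h 0 t0 x -> seg h' s 1 x) -> ~ e y0 -> ~ A' y0 -> False.
Proof.
  intros (oe & _ & maxe) Hh oA' Hh' Hs Ha Ht0 sub ey0 Ay0.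
  pose proof (end_limit_not_in e h Hh (h' s) Ha) as ea.
  pose proof (end_covers_right e A' h h' s t0 oe Hh oA' Hh' Hs Ha Ht0 sub) as cover.
  pose proof (arc_reverse e h Hh) as Hrev.
  destruct (end_limit_exists d Hd e _ oe Hrev K lc) as (b & Hb).
  (* [b] is the other end of [e]. If it is [h' s] as well, a return from the right would cover a
     stretch of [h'] twice, and one from the left would make [e] together with [h' s] clopen. *)
  destruct (classic (h' s = b)) as [eq | ne].
  - subst b.
    destruct (end_side e A' _ h' s oe Hrev oA' Hh' Hs Hb) as (t1 & Ht1 & [sub1 | sub1]).
    + destruct (cover (1 / 2)) as (r1 & Hr1 & c1); [lra | ].
      destruct (end_covers_right e A' _ h' s t1 oe Hrev oA' Hh' Hs Hb Ht1 sub1 (1 / 2))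
        as (r2 & Hr2 & c2); [lra | ].
      rewrite seg_reverse in c2.
      set (u := (s + Rmin r1 r2) / 2). pose proof (Rmin_l r1 r2). pose proof (Rmin_r r1 r2).
      assert (s < Rmin r1 r2) by (apply Rmin_glb_lt; lra).
      destruct (c1 (h' u)) as (v1 & Hv1 & e1). { exists u. split; auto. unfold u. lra. }
      destruct (c2 (h' u)) as (v2 & Hv2 & e2). { exists u. split; auto. unfold u. lra. }
      rewrite <- e2 in e1. apply (arc_inj e h Hh) in e1; lra.
    + destruct (end_covers_right e A' (fun t => h (1 - t)) (fun t => h' (1 - t)) (1 - s) t1)
        with (tau := 1 / 2) as (r2 & Hr2 & c2); auto; try lra.
      { apply arc_reverse; auto. }
      { replace (1 - (1 - s)) with s by lra. auto. }
      { rewrite (seg_reverse h'). replace (1 - 1) with 0 by lra.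
        replace (1 - (1 - s)) with s by lra. auto. }
      rewrite !seg_reverse in c2. replace (1 - (1 - s)) with s in c2 by lra.
      destruct (cover (1 / 2)) as (r1 & Hr1 & c1); [lra | ].
      assert (all : e y0 \/ y0 = h' s).
      { apply (connected_clopen (fun x => e x \/ x = h' s) (h' s) y0 cX); auto.
        - apply open_local. intros x [ex | ->]; [exists e; auto | ].
          exists (seg h' (1 - r2) r1). repeat split.
          + apply (seg_open A'); auto; lra.
          + exists s. split; auto. lra.
          + intros y (u & Hu & <-). destruct (Rtotal_order u s) as [lt | [-> | gt]]; auto; left.
            * destruct (c2 (h' u)) as (v & Hv & <-). { exists u. split; auto. lra. }
              apply (arc_in e h Hh). lra.
            * destruct (c1 (h' u)) as (v & Hv & <-). { exists u. split; auto. lra. }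
              apply (arc_in e h Hh). lra.
        - apply open_local. intros x Hx.
          destruct (not_closure_nbhd e x) as (U & oU & Ux & HU).
          { intros Hcl. destruct (arc_closure d Hd e h (h' s) (h' s) x); auto. tauto. }
          exists (fun y => U y /\ y <> h' s). split; [ | split].
          + apply open_inter; auto. apply (open_neq d Hd).
          + split; auto.
          + intros y (Uy & yne) [ey | yeq]; [apply (HU y) | ]; auto. }
      destruct all as [ | ->]; auto. apply Ay0, (arc_in A' h' Hh'). auto.
  - destruct (separate d Hd (h' s) b ne) as (U & W & oU & oW & Ua & Wb & dis).
    destruct (Hb W oW Wb) as (t1 & Ht1 & near).
    (* To glue, [h'] just left of [s] must miss [e]. The start of [e] lies to the right of [s], its
       other end lies near [b], and what remains is inside the compact subarc from [lo] to [1 - lo],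
       which avoids a neighbourhood of [h' s]. *)
    set (lo := Rmin t0 t1 / 2). assert (0 < Rmin t0 t1) by (apply Rmin_glb_lt; lra).
    pose proof (Rmin_l t0 t1). pose proof (Rmin_r t0 t1).
    destruct (closed_seg d Hd e h Hh lo (1 - lo) (h' s)) as (U1 & oU1 & Ua1 & HU1);
      unfold lo; try lra.
    { intros t Ht eq. apply ea. rewrite <- eq. apply (arc_in e h Hh). lra. }
    destruct (arc_continuous A' h' Hh' 0 1 s (fun x => U x /\ U1 x)) as (delta & d0 & Hdel);
      auto; try lra.
    { apply open_inter; auto. }
    assert (Rabs (s - delta / 2 - s) < delta).
    { replace (s - delta / 2 - s) with (- (delta / 2)) by lra. apply Rabs_def1; lra. }
    destruct (Hdel (s - delta / 2)) as (Hr & _); auto.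
    destruct (glue_arcs e A' h h' s (s - delta / 2)) as (B & oB & hB & eB & Ba); auto; [lra | | ].
    + intros x (u & Hu & <-) eu.
      assert (Hus : Rabs (u - s) < delta) by (apply Rabs_def1; lra).
      destruct (Hdel u Hus) as (_ & Uu & U1u).
      apply Hh in eu. destruct eu as (t & Ht & eq).
      destruct (Rlt_or_le t t0) as [lt | le].
      * destruct (sub (h t)) as (v & Hv & ev). { exists t. split; auto. lra. }
        rewrite eq in ev. apply (arc_inj A' h' Hh') in ev; lra.
      * destruct (Rlt_or_le (1 - t) t1) as [lt1 | le1].
        -- apply (dis (h' u)); auto. rewrite <- eq. replace t with (1 - (1 - t)) by lra.
           apply near. lra.
        -- apply (HU1 t); [unfold lo; lra | ]. rewrite eq. auto.
    + apply ea. apply (maxe B); auto.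
Qed.

(* An end inside another edge would either extend the edge across that end, against its
   maximality, or close it up to a circle, which would be all of [X]. *)
Lemma edge_end_ground (e : X -> Prop) h a :
  (exists y : X, ground y) -> edge e -> arc_param e h -> end_limit h a -> ground a.
Proof.
  intros (y0 & Gy0) Ee Hh Ha (e' & Ee' & ea').
  assert (ey0 : ~ e y0) by (intros H; apply Gy0; exists e; auto).
  assert (ey0' : ~ e' y0) by (intros H; apply Gy0; exists e'; auto).
  pose proof Ee' as (oe' & (h' & Hh') & _). pose proof Ee as (oe & _).
  change (arc_param e' h') in Hh'.
  apply Hh' in ea'. destruct ea' as (s & Hs & <-).
  destruct (end_side e e' h h' s oe Hh oe' Hh' Hs Ha) as (t0 & Ht0 & [sub | sub]).
  - apply (edge_end_right e e' h h' s t0 y0); auto.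
  - apply (edge_end_right e e' h (fun t => h' (1 - t)) (1 - s) t0 y0); auto; try lra.
    + apply arc_reverse; auto.
    + replace (1 - (1 - s)) with s by lra. auto.
    + rewrite seg_reverse. replace (1 - 1) with 0 by lra.
      replace (1 - (1 - s)) with s by lra. auto.
Qed.

Hypothesis Gne : exists y, @ground X y.

(** [a = b] is allowed: the edge may be a loop. The last clause recognizes whole edges without a
    parametrization. *)
Lemma edge_ends (e : X -> Prop) :
  edge e -> exists a b, ground a /\ ground b /\
    (forall z, closure e z -> e z \/ z = a \/ z = b) /\
    (forall D g g', connected_set D -> (forall x, D x -> e x) -> closure D g -> ground g ->
       closure D g' -> ground g' -> g <> g' -> forall x, e x -> D x).
Proof.
  intros Ee. pose proof Ee as (oe & (h & Hh) & _). change (arc_param e h) in Hh.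
  pose proof (arc_reverse e h Hh) as Hrev.
  destruct (end_limit_exists d Hd e h oe Hh K lc) as (a & Ha).
  destruct (end_limit_exists d Hd e _ oe Hrev K lc) as (b & Hb).
  exists a, b. repeat split.
  - apply (edge_end_ground e h); auto.
  - apply (edge_end_ground e (fun t => h (1 - t))); auto.
  - intros z. apply (arc_closure d Hd e h); auto.
  - intros D g g' cD De Hg Gg Hg' Gg'.
    apply (connected_two_ends d Hd e D h a b g g'); auto.
    + intros eg. apply Gg. exists e. auto.
    + intros eg. apply Gg'. exists e. auto.
Qed.

Lemma edge_closure (e : X -> Prop) z : edge e -> closure e z -> e z \/ ground z.
Proof.
  intros Ee Hz. destruct (edge_ends e Ee) as (a & b & Ga & Gb & H & _).
  destruct (H z Hz) as [ | [-> | ->]]; auto.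
Qed.

Lemma edge_connected (e : X -> Prop) : edge e -> connected_set e.
Proof. intros (oe & (h & Hh) & _). apply (arc_connected e h Hh). Qed.

Lemma edge_nonempty (e : X -> Prop) : edge e -> exists x y, e x /\ e y /\ x <> y.
Proof.
  intros (oe & (h & Hh) & _). exists (h (1 / 3)), (h (2 / 3)).
  repeat split; try (apply (arc_in e h Hh); lra).
  intros eq. apply (arc_inj e h Hh) in eq; lra.
Qed.

(** Off the ground space an edge is clopen, since its closure adds only ground points. *)
Lemma connected_in_edge (e D : X -> Prop) x :
  edge e -> connected_set D -> (forall y, D y -> ~ ground y) -> D x -> e x ->
  forall y, D y -> e y.
Proof.
  intros Ee cD DG Dx ex y Dy.
  apply (connected_side D e (fun z => ~ closure e z) x y); auto.
  - apply Ee.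
  - apply open_not_closure.
  - intros z Dz. destruct (classic (closure e z)) as [Hz | ]; auto.
    destruct (edge_closure e z Ee Hz); auto. exfalso. apply (DG z); auto.
  - intros z _ ez Hz. apply Hz, subset_closure, ez.
Qed.

Lemma edges_meet_eq (e e' : X -> Prop) x : edge e -> edge e' -> e x -> e' x -> e = e'.
Proof.
  intros Ee Ee' ex ex'. apply pred_ext. intros y. split; intros Hy.
  - apply (connected_in_edge e' e x); auto.
    + apply edge_connected; auto.
    + intros z ez Gz. apply Gz. exists e. auto.
  - apply (connected_in_edge e e' x); auto.
    + apply edge_connected; auto.
    + intros z ez Gz. apply Gz. exists e'. auto.
Qed.

End Ends.

(** * Finiteness of large edges and existence of small ones *)

Lemma open_not_ground {X : TopSpace} : is_open (fun x : X => ~ ground x).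
Proof.
  apply open_local. intros x Gx. apply NNPP in Gx. destruct Gx as (e & Ee & ex).
  exists e. repeat split; auto; [apply Ee | ]. intros y ey Gy. apply Gy. exists e. auto.
Qed.

Lemma open_off_closures {X : TopSpace} (l : list (X -> Prop)) :
  is_open (fun z => forall e, In e l -> ~ closure e z).
Proof.
  induction l as [ | e l IH].
  - replace (fun z : X => _) with (fun _ : X => True); [apply open_full | ].
    apply pred_ext. intros z. split; [intros _ e [] | auto].
  - replace (fun z : X => _)
      with (fun z => ~ closure e z /\ forall e', In e' l -> ~ closure e' z).
    + apply open_inter; auto. apply open_not_closure.
    + apply pred_ext. intros z. split.
      * intros (H & H') e' [<- | He']; auto.
      * intros H. split; intros; apply H; [left | right]; auto.
Qed.

Section SmallEdges.
Context {X : TopSpace} (d : X -> X -> R) (Hd : metrizes X d).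
Hypotheses (K : compact_set (@full X)) (cX : connected_set (@full X))
  (lc : locally_connected_set (@full X)) (Gne : exists y, @ground X y).

Lemma connected_sphere (C : X -> Prop) x y z c :
  connected_set C -> C y -> C z -> d x y < c < d x z -> exists w, C w /\ d x w = c.
Proof.
  intros cC Cy Cz Hc. apply NNPP. intros no. apply cC.
  exists (fun w => d x w < c), (fun w => c < d x w). repeat split.
  - apply (ball_open d Hd).
  - apply (coball_open d Hd).
  - intros w Cw. destruct (Rtotal_order (d x w) c) as [ | [ | ]]; auto. exfalso. eauto.
  - exists y. tauto.
  - exists z. tauto.
  - intros w _ H H'. lra.
Qed.

(** By compactness it is enough to look near one point. An edge through a small connected
    neighbourhood of a ground point has an end there by boundary bumping; near a point of an edge
    there is only that edge. *)
Lemma sphere_edges x r1 c r2 :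
  r1 < c < r2 -> exists l, forall e z, edge e -> e z -> d x z = c ->
    (In e l \/ exists g, ground g /\ closure e g /\ r1 < d x g < r2).
Proof.
  intros Hc.
  destruct (compact_induction (fun U => exists l, forall e z, U z -> edge e -> e z ->
    d x z = c -> (In e l \/ exists g, ground g /\ closure e g /\ r1 < d x g < r2)) K)
    as (l & Hl).
  - exists nil. tauto.
  - intros A B (l & Hl) (l' & Hl'). exists (l ++ l'). intros e z [Az | Bz] Ee ez Hz.
    + destruct (Hl e z Az Ee ez Hz); auto. left. apply in_or_app. auto.
    + destruct (Hl' e z Bz Ee ez Hz); auto. left. apply in_or_app. auto.
  - intros A B AB (l & Hl). exists l. intros e z Az. apply Hl; auto.
  - intros z0. destruct (classic (ground z0)) as [G0 | G0].
    + destruct (classic (r1 < d x z0 < r2)) as [in_shell | out].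
      * destruct (connected_nbhd z0 (fun z => r1 < d x z /\ d x z < r2) lc)
          as (N & oN & Nz0 & HN & cN); auto.
        { apply open_inter; [apply (coball_open d Hd) | apply (ball_open d Hd)]. }
        exists N. repeat split; auto. exists nil. intros e z Nz Ee ez _. right.
        destruct (connected_reach ground N z z0) as (g & D & Gg & Ng & cD & Dz & Dg & DN); auto.
        { apply open_not_ground. }
        { intros Gz. apply Gz. exists e. auto. }
        exists g. repeat split; auto; try apply HN; auto.
        apply (closure_incl D); auto.
        apply (connected_in_edge d Hd K cX lc Gne e D z); auto. apply DN.
      * exists (fun z => d x z < c \/ c < d x z). repeat split.
        -- apply open_or; [apply (ball_open d Hd) | apply (coball_open d Hd)].
        -- destruct (Rtotal_order (d x z0) c) as [ | [ | ]]; auto. exfalso. apply out. lra.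
        -- exists nil. intros e z Hz _ _ eq. lra.
    + apply NNPP in G0. destruct G0 as (e0 & Ee0 & e0z). exists e0.
      repeat split; auto; [apply Ee0 | ]. exists (e0 :: nil). intros e z e0z' Ee ez _. left.
      left. apply (edges_meet_eq d Hd K cX lc Gne e0 e z); auto.
  - exists l. intros e z. apply Hl. exact I.
Qed.

(* The edges form a null sequence: an edge crossing three concentric shells not in a fixed finite
   list would have an end in each of them. *)
Lemma null_edges x r :
  0 < r -> exists l, forall e, edge e -> (exists y, e y /\ d x y < r / 4) ->
    ((forall y, e y -> d x y < r) \/ In e l).
Proof.
  intros r0.
  destruct (sphere_edges x (r / 4) (3 * r / 8) (r / 2)) as (l1 & H1); [lra | ].
  destruct (sphere_edges x (r / 2) (5 * r / 8) (3 * r / 4)) as (l2 & H2); [lra | ].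
  destruct (sphere_edges x (3 * r / 4) (7 * r / 8) r) as (l3 & H3); [lra | ].
  exists (l1 ++ l2 ++ l3). intros e Ee (y & ey & Hy).
  destruct (classic (forall y, e y -> d x y < r)) as [ | out]; auto. right.
  apply not_all_ex_not in out. destruct out as (z & Hz). apply imply_to_and in Hz.
  destruct Hz as (ez & Hz).
  pose proof (edge_connected e Ee) as ce.
  destruct (connected_sphere e x y z (3 * r / 8)) as (w1 & ew1 & Hw1); auto; [lra | ].
  destruct (connected_sphere e x y z (5 * r / 8)) as (w2 & ew2 & Hw2); auto; [lra | ].
  destruct (connected_sphere e x y z (7 * r / 8)) as (w3 & ew3 & Hw3); auto; [lra | ].
  destruct (H1 e w1 Ee ew1 Hw1) as [ | (g1 & G1 & c1 & b1)]; [apply in_or_app; auto | ].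
  destruct (H2 e w2 Ee ew2 Hw2) as [ | (g2 & G2 & c2 & b2)].
  { apply in_or_app. right. apply in_or_app. auto. }
  destruct (H3 e w3 Ee ew3 Hw3) as [ | (g3 & G3 & c3 & b3)].
  { apply in_or_app. right. apply in_or_app. auto. }
  exfalso. destruct (edge_ends d Hd K cX lc Gne e Ee) as (a & b & _ & _ & ends & _).
  assert (E : forall g, ground g -> closure e g -> g = a \/ g = b).
  { intros g Gg cg. destruct (ends g cg); auto. exfalso. apply Gg. exists e. auto. }
  destruct (E g1 G1 c1), (E g2 G2 c2), (E g3 G3 c3); subst; lra.
Qed.

Lemma ends_list (l : list (X -> Prop)) :
  exists m, forall e g, In e l -> edge e -> ground g -> closure e g -> In g m.
Proof.
  induction l as [ | e l (m & IH)].
  - exists nil. intros e g [].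
  - destruct (classic (edge e)) as [Ee | Ee].
    + destruct (edge_ends d Hd K cX lc Gne e Ee) as (a & b & _ & _ & ends & _).
      exists (a :: b :: m). intros e' g [<- | He'] Ee' Gg cg.
      * destruct (ends g cg) as [eg | [-> | ->]]; [ | left | right; left]; auto.
        exfalso. apply Gg. exists e. auto.
      * right. right. apply (IH e'); auto.
    + exists m. intros e' g [<- | He']; [tauto | ]. apply IH; auto.
Qed.

(** The edges near [x] that are not small are finitely many and so are their ends. A ground point
    near [x] other than these ends has a neighbourhood off all these edges, where density supplies
    another edge. *)
Lemma small_edge x r :
  (forall U (l : list X), is_open U -> U x -> exists y, ground y /\ U y /\ ~ In y l) ->
  (forall y : X, closure (bigU edge) y) -> 0 < r ->
  exists e, edge e /\ forall y, e y -> d x y < r.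
Proof.
  intros perfect dense r0.
  destruct (null_edges x r r0) as (l0 & Hl0).
  destruct (ends_list l0) as (m & Hm).
  destruct (perfect (fun y => d x y < r / 4) m) as (y & Gy & Hy & ym).
  { apply (ball_open d Hd). }
  { rewrite (metric_refl d Hd). lra. }
  (* The list from [null_edges] may contain sets that are not edges, and [m] does not control their
     closures. *)
  set (l := filter (fun e => if excluded_middle_informative (edge e) then true else false) l0).
  assert (Hl : forall e, In e l <-> In e l0 /\ edge e).
  { intros e. unfold l. rewrite filter_In.
    destruct (excluded_middle_informative (edge e)); intuition. discriminate. }
  destruct (dense y (fun z => d x z < r / 4 /\ forall e, In e l -> ~ closure e z))
    as (z & (Hz & off) & e & Ee & ez).
  - apply open_inter; [apply (ball_open d Hd) | apply open_off_closures].
  - split; auto. intros e He ce. apply Hl in He. apply ym. apply (Hm e); tauto.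
  - exists e. split; auto. destruct (Hl0 e Ee) as [ | He]; eauto.
    exfalso. apply (off e); [apply Hl; auto | apply subset_closure; auto].
Qed.

End SmallEdges.

(** * Edges crossing clopen cuts *)

Section Product.
Context {X V P : TopSpace} (d : X -> X -> R) (Hd : metrizes X d).
Hypotheses (K : compact_set (@full X)) (cX : connected_set (@full X))
  (lc : locally_connected_set (@full X)) (Gne : exists y, @ground X y)
  (dense : forall x : X, closure (bigU edge) x).
Variable emb : V -> P -> X.
Hypotheses (emb_ground : forall v p, ground (emb v p))
  (emb_onto : forall x, ground x -> exists v p, x = emb v p)
  (emb_inj : forall v p v' p', emb v p = emb v' p' -> v = v' /\ p = p')
  (emb_box : forall O O', is_open O -> is_open O' ->
     exists U, is_open U /\ forall v p, U (emb v p) <-> O v /\ O' p)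
  (emb_cont : forall U v p, is_open U -> U (emb v p) ->
     exists O O', is_open O /\ is_open O' /\ O v /\ O' p /\
       forall v' p', O v' -> O' p' -> U (emb v' p')).
Hypotheses (KV : compact_set (@full V)) (zdV : zero_dimensional V).
Hypotheses (KP : compact_set (@full P)) (lcP : locally_connected_set (@full P))
  (perfectP : forall (O : P -> Prop) (l : list P), is_open O -> (exists p, O p) ->
     exists q, O q /\ ~ In q l).
Variable dP : P -> P -> R.
Hypothesis HdP : metrizes P dP.

Definition crosses (e : X -> Prop) (A : V -> Prop) : Prop :=
  exists w1 p1 w2 p2, closure e (emb w1 p1) /\ closure e (emb w2 p2) /\ A w1 /\ ~ A w2.

Definition small (r : R) (e : X -> Prop) : Prop := exists x, forall y, e y -> d x y < r.

(** Cuts instead of chains of edges: a fibre need not contain the end of any edge, so chains might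
    not reach it, whereas this relation is an equivalence with open classes. *)
Definition link (r : R) (q : P) (v v' : V) : Prop :=
  forall A, clopen A -> A v -> ~ A v' ->
    exists e u, edge e /\ (forall y, e y -> d (emb u q) y < r) /\ crosses e A.

Lemma crosses_compl e (A : V -> Prop) : crosses e (fun v => ~ A v) -> crosses e A.
Proof.
  intros (w1 & p1 & w2 & p2 & c1 & c2 & A1 & A2). exists w2, p2, w1, p1.
  repeat split; auto. apply NNPP, A2.
Qed.

(** In the second case [D] avoids the ground space, so [y] gets to [emb v p] along a part of one
    edge. *)
Definition reaches (S : X -> Prop) (y : X) (v : V) (p : P) : Prop :=
  S (emb v p) /\
  (y = emb v p \/
   exists D, connected_set D /\ D y /\ closure D (emb v p) /\ forall z, D z -> S z /\ ~ ground z).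

(** Near a ground point over [A], boundary bumping leads every other point to a ground point that is
    still over [A]. *)
Lemma reaches_open S (A : V -> Prop) :
  is_open S -> is_open A -> is_open (fun y => S y /\ exists v p, A v /\ reaches S y v p).
Proof.
  intros oS oA. apply open_local.
  intros y (Sy & v & p & Av & Svp & [-> | (D & cD & Dy & Dvp & DS)]).
  - destruct (emb_box A full) as (UA & oUA & HUA); auto. { apply open_full. }
    destruct (connected_nbhd (emb v p) (fun z => S z /\ UA z) lc) as (N & oN & Nvp & HN & cN).
    { apply open_inter; auto. }
    { split; auto. apply HUA. split; auto. exact I. }
    exists N. repeat split; auto; [apply HN; auto | ].
    destruct (classic (ground y)) as [Gy | Gy].
    + destruct (emb_onto y Gy) as (v' & p' & ->). exists v', p'. destruct (HN _ H) as (Sy' & Uy).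
      apply HUA in Uy. repeat split; try tauto.
    + destruct (connected_reach ground N y (emb v p)) as (g & D & Gg & Ng & cD & Dy & Dg & DN);
        auto using open_not_ground.
      destruct (emb_onto g Gg) as (v' & p' & ->). exists v', p'. destruct (HN _ Ng) as (Sg & Ug).
      apply HUA in Ug. split; [tauto | ]. split; auto. right. exists D. repeat split; auto.
      * apply HN, DN. auto.
      * apply DN. auto.
  - destruct (connected_nbhd y (fun z => S z /\ ~ ground z) lc) as (N & oN & Ny & HN & cN).
    { apply open_inter; auto using open_not_ground. }
    { apply DS; auto. }
    exists N. repeat split; auto; [apply HN; auto | ].
    exists v, p. split; auto. split; auto. right. exists (fun z => D z \/ N z). repeat split; auto.
    + apply (connected_union D N y); auto.
    + apply (closure_incl D); auto.
    + destruct H0; [apply DS | apply HN]; auto.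
    + destruct H0; [apply DS | apply HN]; auto.
Qed.

(** The points reaching the ground over [A] and those reaching it over the complement form two open
    sets covering [S], so some [y] does both. The two pieces through [y] lie in one edge and
    approach two distinct ends of it, so together they are the whole edge. *)
Lemma edge_across S v p v' p' A :
  is_open S -> connected_set S -> S (emb v p) -> S (emb v' p') ->
  clopen A -> A v -> ~ A v' ->
  exists e, edge e /\ (forall y, e y -> S y) /\ crosses e A.
Proof.
  intros oS cS Svp Svp' clA Av Av'. apply NNPP. intros none. apply cS.
  exists (fun y => S y /\ exists v p, A v /\ reaches S y v p),
         (fun y => S y /\ exists v p, ~ A v /\ reaches S y v p).
  repeat split.
  - apply reaches_open; auto. apply clA.
  - apply (reaches_open S (fun v => ~ A v)); auto. apply clA.
  - intros y Sy. assert (R : exists v p, reaches S y v p).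
    { destruct (classic (ground y)) as [Gy | Gy].
      - destruct (emb_onto y Gy) as (w & q & ->). exists w, q. split; auto.
      - destruct (connected_reach ground S y (emb v p)) as (g & D & Gg & Sg & cD & Dy & Dg & DS);
          auto using open_not_ground.
        destruct (emb_onto g Gg) as (w & q & ->). exists w, q. split; eauto 8. }
    destruct R as (w & q & R). destruct (classic (A w)); [left | right]; eauto 6.
  - exists (emb v p). repeat split; auto. exists v, p. repeat split; auto.
  - exists (emb v' p'). repeat split; auto. exists v', p'. repeat split; auto.
  - intros y Sy (_ & w & q & Aw & Sw & Hw) (_ & w' & q' & Aw' & Sw' & Hw').
    destruct Hw as [-> | (D & cD & Dy & Dg & DS)], Hw' as [eq | (D' & cD' & Dy' & Dg' & DS')].
    + apply emb_inj in eq. destruct eq as (-> & _). auto.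
    + apply (DS' _ Dy'), emb_ground.
    + subst y. apply (DS _ Dy), emb_ground.
    + destruct (DS y Dy) as (_ & Gy). apply NNPP in Gy. destruct Gy as (e & Ee & ey).
      assert (DG : forall z, D z \/ D' z -> S z /\ ~ ground z).
      { intros z [Dz | Dz]; [apply DS | apply DS']; auto. }
      assert (cDD : connected_set (fun z => D z \/ D' z)) by (apply (connected_union D D' y); auto).
      assert (De : forall z, D z \/ D' z -> e z).
      { apply (connected_in_edge d Hd K cX lc Gne e _ y); auto. intros z Hz. apply DG; auto. }
      destruct (edge_ends d Hd K cX lc Gne e Ee) as (_ & _ & _ & _ & _ & two).
      apply none. exists e. split; [auto | split].
      * intros z ez. apply DG.
        apply (two (fun z => D z \/ D' z) (emb w q) (emb w' q')); auto.
        -- apply (closure_incl D); auto.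
        -- apply (closure_incl D'); auto.
        -- intros eq. apply emb_inj in eq. destruct eq as (-> & _). auto.
      * exists w, q, w', q'. repeat split; auto.
        -- apply (closure_incl D); auto.
        -- apply (closure_incl D'); auto.
Qed.

Lemma link_refl r q v : link r q v v.
Proof. intros A _ Av Av'. tauto. Qed.

Lemma link_sym r q v v' : link r q v v' -> link r q v' v.
Proof.
  intros L A clA Av' Av. destruct (L (fun w => ~ A w)) as (e & u & Ee & He & cr); auto.
  - apply clopen_compl; auto.
  - exists e, u. split; [auto | split; auto]. apply crosses_compl; auto.
Qed.

Lemma link_trans r q v v' v'' : link r q v v' -> link r q v' v'' -> link r q v v''.
Proof.
  intros L L' A clA Av Av''. destruct (classic (A v')); [apply L' | apply L]; auto.
Qed.

(** A connected neighbourhood of [emb v q] inside the ball meets the fibres over all [v'] near [v],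
    so every cut between [v] and [v'] is crossed inside it. *)
Lemma link_nbhd r q v :
  0 < r -> exists O, is_open O /\ O v /\ forall v', O v' -> link r q v v'.
Proof.
  intros r0.
  destruct (connected_nbhd (emb v q) (fun y => d (emb v q) y < r) lc) as (S & oS & Svq & HS & cS).
  { apply (ball_open d Hd). }
  { rewrite (metric_refl d Hd). auto. }
  destruct (emb_cont S v q oS Svq) as (O & O' & oO & oO' & Ov & Oq & HO).
  exists O. repeat split; auto. intros v' Ov' A clA Av Av'.
  destruct (edge_across S v q v' q A) as (e & Ee & eS & cr); auto.
  exists e, v. auto.
Qed.

Lemma link_clopen r q v : 0 < r -> clopen (link r q v).
Proof.
  intros r0. split; apply open_local; intros w Hw;
    destruct (link_nbhd r q w r0) as (O & oO & Ow & HO); exists O; repeat split; auto.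
  - intros w' Ow'. apply link_trans with w; auto.
  - intros w' Ow' L. apply Hw. apply link_trans with w'; auto. apply link_sym; auto.
Qed.

Lemma edge_link e u q r w1 p1 w2 p2 :
  edge e -> (forall y, e y -> d (emb u q) y < r) ->
  closure e (emb w1 p1) -> closure e (emb w2 p2) -> link r q w1 w2.
Proof.
  intros Ee He c1 c2 A clA A1 A2. exists e, u. split; [auto | split; auto].
  exists w1, p1, w2, p2. auto.
Qed.

Lemma small_ends r e g g' : small r e -> closure e g -> closure e g' -> d g g' <= 2 * r.
Proof.
  intros (x & Hx) Hg Hg'.
  pose proof (closure_ball_le d Hd e x r g Hx Hg).
  pose proof (closure_ball_le d Hd e x r g' Hx Hg').
  pose proof (metric_tri d Hd g x g'). rewrite (metric_sym d Hd g x) in H1. lra.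
Qed.

(** Ground points over unrelated points of [V] never share a small neighbourhood, whatever their
    heights, so a Lebesgue number separates them. Off the ground space, which is closed, there is
    nothing to check. *)
Lemma uniform_separation (T : V -> V -> Prop) :
  (forall v, exists O, is_open O /\ O v /\ forall w w', O w -> O w' -> T w w') ->
  exists c, 0 < c /\ forall v v' p p', ~ T v v' -> c <= d (emb v p) (emb v' p').
Proof.
  intros loc.
  destruct (lebesgue d Hd (fun y z => forall v p v' p', y = emb v p -> z = emb v' p' -> T v v') K)
    as (c & c0 & Hc).
  - intros x. destruct (classic (ground x)) as [Gx | Gx].
    + destruct (emb_onto x Gx) as (v & p & ->). destruct (loc v) as (O & oO & Ov & HO).
      destruct (emb_box O full) as (U & oU & HU); auto. { apply open_full. }
      exists U. repeat split; auto.
      * apply HU. split; auto. exact I.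
      * intros y z Uy Uz w p1 w' p2 -> ->. apply HU in Uy. apply HU in Uz. apply HO; tauto.
    + exists (fun x => ~ ground x). repeat split; auto using open_not_ground.
      intros y z Gy _ v p v' p' -> _. exfalso. auto.
  - exists c. split; auto. intros v v' p p' nT. apply Rnot_lt_le. intros lt.
    apply nT. apply (Hc _ _ lt v p v' p'); auto.
Qed.

Lemma clopen_separation (A : V -> Prop) :
  clopen A ->
  exists c, 0 < c /\ forall v v' p p', A v -> ~ A v' -> c <= d (emb v p) (emb v' p').
Proof.
  intros [oA oA']. destruct (uniform_separation (fun v v' => A v -> A v')) as (c & c0 & Hc).
  - intros v. destruct (classic (A v)) as [Av | Av].
    + exists A. auto.
    + exists (fun w => ~ A w). repeat split; auto. tauto.
  - exists c. split; [exact c0 | ]. intros v v' p p' Av Av'. apply Hc. tauto.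
Qed.

Lemma link_separation r (Q : list P) :
  0 < r -> exists c, 0 < c /\ forall q, In q Q -> forall v v' p p',
    ~ link r q v v' -> 2 * c < d (emb v p) (emb v' p').
Proof.
  intros r0. apply (list_uniform (fun c q => forall v v' p p',
    ~ link r q v v' -> 2 * c < d (emb v p) (emb v' p'))).
  - intros c c' q Hc H v v' p p' nL. specialize (H v v' p p' nL). lra.
  - intros q _. destruct (uniform_separation (link r q)) as (c & c0 & Hc).
    + intros v. destruct (link_nbhd r q v r0) as (O & oO & Ov & HO). exists O. repeat split; auto.
      intros w w' Ow Ow'. apply link_trans with v; auto. apply link_sym; auto.
    (* A third, because twice the constant must be strictly below the separation. *)
    + exists (c / 3). split; [lra | ]. intros v v' p p' nL. specialize (Hc v v' p p' nL). lra.
Qed.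

Lemma slice_separation (Q Q' : list P) :
  (forall q, In q Q -> ~ In q Q') ->
  exists c, 0 < c /\ forall q, In q Q -> forall q', In q' Q' -> forall v v',
    2 * c < d (emb v q) (emb v' q').
Proof.
  intros disj. apply (list_uniform (fun c q => forall q', In q' Q' -> forall v v',
    2 * c < d (emb v q) (emb v' q'))).
  { intros c c' q Hc H q' Hq' v v'. specialize (H q' Hq' v v'). lra. }
  intros q Hq. apply (list_uniform (fun c q' => forall v v', 2 * c < d (emb v q) (emb v' q'))).
  { intros c c' q' Hc H v v'. specialize (H v v'). lra. }
  intros q' Hq'. assert (ne : q <> q') by (intros ->; apply (disj q' Hq Hq')).
  destruct (lebesgue d Hd (fun y z => forall v v', y = emb v q -> z = emb v' q' -> False) K)
    as (c & c0 & Hc).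
  - assert (avoid : forall v p a, p <> a ->
      exists U, is_open U /\ U (emb v p) /\ forall w, ~ U (emb w a)).
    { intros v p a pa. destruct (emb_box full (fun p => p <> a)) as (U & oU & HU).
      { apply open_full. }
      { apply (open_neq dP HdP). }
      exists U. repeat split; auto.
      - apply HU. split; auto. exact I.
      - intros w Uw. apply HU in Uw. tauto. }
    intros x. destruct (classic (ground x)) as [Gx | Gx].
    + destruct (emb_onto x Gx) as (v & p & ->). destruct (classic (p = q)) as [-> | pq].
      * destruct (avoid v q q' ne) as (U & oU & Uv & HU). exists U. repeat split; auto.
        intros y z Uy Uz w w' -> ->. apply (HU w'); auto.
      * destruct (avoid v p q pq) as (U & oU & Uv & HU). exists U. repeat split; auto.
        intros y z Uy Uz w w' -> ->. apply (HU w); auto.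
    + exists (fun x => ~ ground x). repeat split; auto using open_not_ground.
      intros y z Gy _ v v' -> _. auto.
  - exists (c / 3). split; [lra | ]. intros v v'. apply Rnot_le_lt. intros le.
    apply (Hc (emb v q) (emb v' q')) with v v'; auto. lra.
Qed.

(** An edge in the ball of radius [r / 2] around [emb v q] serves all nearby points of [V] with
    radius [r]; compactness of [V] then makes the lower bound on size uniform. *)
Lemma small_edge_uniform r (Q : list P) :
  0 < r -> exists c, 0 < c /\ forall q, In q Q -> forall v,
    exists e, edge e /\ (forall y, e y -> d (emb v q) y < r) /\ ~ small c e.
Proof.
  intros r0.
  assert (mono : forall c c' e, 0 < c' <= c -> ~ small c e -> ~ small c' e).
  { intros c c' e Hc nS (x & Hx). apply nS. exists x. intros y ey. specialize (Hx y ey). lra. }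
  apply (list_uniform (fun c q => forall v,
    exists e, edge e /\ (forall y, e y -> d (emb v q) y < r) /\ ~ small c e)).
  { intros c c' q Hc H v. destruct (H v) as (e & Ee & He & nS). exists e. eauto. }
  intros q _. apply (compact_uniform (fun c v =>
    exists e, edge e /\ (forall y, e y -> d (emb v q) y < r) /\ ~ small c e) KV).
  { intros c c' v Hc (e & Ee & He & nS). exists e. eauto. }
  intros v. destruct (small_edge d Hd K cX lc Gne (emb v q) (r / 2)) as (e & Ee & He); auto; try lra.
  { intros U l oU Uvq. destruct (emb_cont U v q oU Uvq) as (O & O' & oO & oO' & Ov & Oq & HO).
    (* [pr] recovers the [P] coordinate and so turns forbidden points of [X] into forbidden points
       of [P]. *)
    set (pr := fun x => epsilon (inhabits q) (fun p => exists w, x = emb w p)).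
    destruct (perfectP O' (map pr l) oO') as (p & Op & pl); eauto.
    exists (emb v p). repeat split; auto. intros Hin. apply pl.
    replace p with (pr (emb v p)); [apply in_map; auto | ].
    destruct (epsilon_spec (inhabits q) (fun p0 => exists w, emb v p = emb w p0)) as (w & Hw).
    { eauto. }
    fold (pr (emb v p)) in Hw. apply emb_inj in Hw. symmetry. tauto. }
  destruct (emb_cont (fun y => d (emb v q) y < r / 2) v q) as (O & O' & oO & oO' & Ov & Oq & HO).
  { apply (ball_open d Hd). }
  { rewrite (metric_refl d Hd). lra. }
  destruct (edge_nonempty e Ee) as (a & b & ea & eb & ne).
  assert (0 < d a b).
  { destruct (metric_pos d Hd a b) as [ | eq]; auto. exfalso. apply ne, (metric_eq d Hd). auto. }
  exists O, (d a b / 2). repeat split; auto; [lra | ].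
  intros w Ow. exists e. split; [auto | split].
  - intros y ey. specialize (He y ey). specialize (HO w q Ow Oq). simpl in HO.
    pose proof (metric_tri d Hd (emb w q) (emb v q) y).
    rewrite (metric_sym d Hd (emb w q) (emb v q)) in H0. lra.
  - intros (x & Hx). pose proof (Hx a ea). pose proof (Hx b eb).
    pose proof (metric_tri d Hd a x b). rewrite (metric_sym d Hd a x) in H2. lra.
Qed.

(** * Levels of edges *)

Section Scales.
Variables (Q : nat -> list P) (r : nat -> R).
Hypotheses (Q_dense : forall O : P -> Prop, is_open O -> (exists p, O p) ->
    exists N, forall n, (N <= n)%nat -> exists q, In q (Q n) /\ O q)
  (r_pos : forall n, 0 < r n)
  (r_step : forall n, r (S n) <= r n)
  (r_lim : forall eps, 0 < eps -> exists N, forall n, (N <= n)%nat -> r n < eps)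
  (r_slices : forall n q q' v v', In q (Q n) -> In q' (Q (S n)) ->
     2 * r n < d (emb v q) (emb v' q'))
  (r_link : forall n q v v' p p', In q (Q n) -> ~ link (r n) q v v' ->
     2 * r (S n) < d (emb v p) (emb v' p'))
  (r_edge : forall n q v, In q (Q n) ->
     exists e, edge e /\ (forall y, e y -> d (emb v q) y < r n) /\ ~ small (r (S n)) e).

Definition level_edge (n : nat) (e : X -> Prop) : Prop :=
  edge e /\ (exists q v, In q (Q n) /\ forall y, e y -> d (emb v q) y < r n) /\
  ~ small (r (n + 3)) e.

Lemma r_anti m n : (m <= n)%nat -> r n <= r m.
Proof.
  induction 1; [lra | ]. pose proof (r_step m0). lra.
Qed.

Lemma small_mono m n e : (m <= n)%nat -> small (r n) e -> small (r m) e.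
Proof.
  intros le (x & Hx). exists x. intros y ey. specialize (Hx y ey).
  pose proof (r_anti m n le). lra.
Qed.

(** The excluded case has equal parity, where an overlap does no harm. *)
Lemma level_edge_disjoint m n e :
  (m < n)%nat -> n <> (m + 2)%nat -> level_edge m e -> level_edge n e -> False.
Proof.
  intros lt ne (Ee & (q & v & Hq & He) & nS) (_ & (q' & v' & Hq' & He') & _).
  destruct (Nat.eq_dec n (S m)) as [-> | ne'].
  - destruct (edge_nonempty e Ee) as (y & _ & ey & _).
    pose proof (r_slices m q q' v v' Hq Hq'). pose proof (r_step m).
    pose proof (He y ey). pose proof (He' y ey).
    pose proof (metric_tri d Hd (emb v q) y (emb v' q')).
    rewrite (metric_sym d Hd y (emb v' q')) in H3. lra.
  - apply nS. apply small_mono with n; [lia | ]. exists (emb v' q'). auto.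
Qed.

Lemma ball_ends x s e g g' :
  (forall y, e y -> d x y < s) -> closure e g -> closure e g' -> d g g' <= 2 * s.
Proof. intros He. apply small_ends. exists x. auto. Qed.

(** Once the balls are finer than the gap of [A], no edge inside them crosses [A], so [A] is a union
    of classes. *)
Lemma link_clopen_side n q v v' (A : V -> Prop) c :
  clopen A -> (forall v v' p p', A v -> ~ A v' -> c <= d (emb v p) (emb v' p')) ->
  2 * r n < c -> A v -> link (r n) q v v' -> A v'.
Proof.
  intros clA Hc Hr Av L. apply NNPP. intros Av'.
  destruct (L A clA Av Av') as (e & u & Ee & He & w1 & p1 & w2 & p2 & c1 & c2 & A1 & A2).
  pose proof (ball_ends _ _ _ _ _ He c1 c2). specialize (Hc w1 w2 p1 p2 A1 A2). lra.
Qed.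

(** Edges of the finer level are too short to leave a class of level [n], at whatever height [q']
    they sit. *)
Lemma link_refine n q q' v v' :
  In q (Q n) -> link (r (S (S n))) q' v v' -> link (r n) q v v'.
Proof.
  intros Hq L. apply NNPP. intros nL.
  destruct (L (link (r n) q v)) as (e & u & Ee & He & w1 & p1 & w2 & p2 & c1 & c2 & L1 & L2);
    auto using link_clopen, link_refl.
  pose proof (ball_ends _ _ _ _ _ He c1 c2).
  assert (nL' : ~ link (r n) q w1 w2).
  { intros L3. apply L2. apply link_trans with w1; auto. }
  pose proof (r_link n q w1 w2 p1 p2 Hq nL'). pose proof (r_step (S n)). lra.
Qed.

(* If the cut [A] splits no class of the next level then the crossing edge is long and hence of
   the present level; otherwise pass to the split class, which is contained in the old one. This
   stops because the levels eventually become finer than [A]. *)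
Lemma cut_level_edge (b N : nat) (qq : nat -> P) :
  (forall i, (N <= i)%nat -> In (qq i) (Q (2 * i + b))) ->
  forall n i A v1 v2 c, (N <= i)%nat -> clopen A ->
    (forall v v' p p', A v -> ~ A v' -> c <= d (emb v p) (emb v' p')) ->
    2 * r (2 * (i + n) + b) < c -> A v1 -> ~ A v2 ->
    link (r (2 * i + b)) (qq i) v1 v2 ->
    exists m e u w1 p1 w2 p2, (N <= m)%nat /\ level_edge (2 * m + b) e /\
      (forall y, e y -> d (emb u (qq m)) y < r (2 * m + b)) /\
      closure e (emb w1 p1) /\ closure e (emb w2 p2) /\ A w1 /\ ~ A w2 /\
      link (r (2 * i + b)) (qq i) v1 w1 /\ link (r (2 * i + b)) (qq i) v1 w2.
Proof.
  intros Hqq. induction n as [ | n IH]; intros i A v1 v2 c Hi clA Hc Hr A1 A2 L.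
  (* [n] counts the steps until the radius falls below the gap of [A]; at 0 the cut can no longer
     split a class. *)
  - exfalso. apply A2. replace (i + 0)%nat with i in Hr by lia.
    apply (link_clopen_side (2 * i + b) (qq i) v1 v2 A c); auto.
  - replace (i + S n)%nat with (S i + n)%nat in Hr by lia.
    pose proof (Hqq i Hi) as Hq.
    assert (Hq' : In (qq (S i)) (Q (S (S (2 * i + b))))).
    { replace (S (S (2 * i + b))) with (2 * S i + b)%nat by lia. apply Hqq. lia. }
    assert (idx : (2 * S i + b)%nat = S (S (2 * i + b))) by lia.
    destruct (classic (exists w1 w2, link (r (2 * i + b)) (qq i) v1 w1 /\
      link (r (2 * i + b)) (qq i) v1 w2 /\ A w1 /\ ~ A w2 /\
      link (r (S (S (2 * i + b)))) (qq (S i)) w1 w2)) as [(w1 & w2 & L1 & L2 & B1 & B2 & L') | no].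
    + destruct (IH (S i) A w1 w2 c) as (m & e & u & x1 & p1 & x2 & p2 & Hm & He & Hball & c1 & c2 &
        C1 & C2 & M1 & M2); auto; try (rewrite idx; auto); try lia.
      rewrite idx in M1, M2.
      exists m, e, u, x1, p1, x2, p2. split; [lia | ]. split; [auto | ].
      repeat split; auto; apply link_trans with w1; auto;
        apply (link_refine _ _ (qq (S i))); auto.
    (* Cutting by [A] within the class forces an edge with one end there and the other outside the
       cut. That edge does not leave the class, so its other end is outside [A]. *)
    + set (k := (2 * i + b)%nat) in *.
      destruct (L (fun w => A w /\ link (r k) (qq i) v1 w))
        as (e & u & Ee & He & w1 & p1 & w2 & p2 & c1 & c2 & (B1 & L1) & B2).
      * apply clopen_and; auto. apply link_clopen; auto.
      * split; auto. apply link_refl.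
      * tauto.
      * assert (L2 : link (r k) (qq i) v1 w2).
        { apply link_trans with w1; auto. apply (edge_link e u (qq i) _ w1 p1 w2 p2); auto. }
        assert (nA : ~ A w2) by tauto.
        exists i, e, u, w1, p1, w2, p2. split; [lia | ]. split; [ | repeat split; auto].
        split; auto. split; [eauto | ].
        (* An edge in a ball of radius [r (k + 3)] would have both ends in one class of level
           [k + 2], which [no] forbids. *)
        intros sm. pose proof (small_ends _ _ _ _ sm c1 c2) as Hsm.
        fold k in Hsm. replace (k + 3)%nat with (S (S (S k))) in Hsm by lia.
        assert (nL : ~ link (r (S (S k))) (qq (S i)) w1 w2) by (intros L'; apply no; eauto 8).
        pose proof (r_link (S (S k)) (qq (S i)) w1 w2 p1 p2 Hq' nL). lra.
Qed.

(** * Density and local connectedness of a single class of edges *)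

Section EdgeClass.
Variables (b : nat) (E : (X -> Prop) -> Prop).
Hypotheses (E_edge : forall e, E e -> edge e)
  (E_level : forall i e, level_edge (2 * i + b) e -> E e).

(** For [q] close to [p], the edge that [r_edge] gives around [emb v q] is too large for the next
    radius, hence for the third next, so it has a level of the right parity. *)
Lemma class_dense x : ground x -> closure (bigU E) x.
Proof.
  intros Gx U oU Ux. destruct (emb_onto x Gx) as (v & p & ->).
  destruct (open_ball_in d Hd U _ oU Ux) as (eta & eta0 & Heta).
  destruct (emb_cont (fun y => d (emb v p) y < eta / 2) v p) as (O & O' & oO & oO' & Ov & Op & HO).
  { apply (ball_open d Hd). }
  { rewrite (metric_refl d Hd). lra. }
  destruct (r_lim (eta / 2)) as (N & HN); [lra | ].
  destruct (Q_dense O' oO') as (N' & HN'); [eauto | ].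
  set (i := (N + N')%nat).
  destruct (HN' (2 * i + b)%nat) as (q & Hq & Oq); [lia | ].
  specialize (HN (2 * i + b)%nat ltac:(lia)).
  destruct (r_edge (2 * i + b) q v Hq) as (e & Ee & He & nS).
  destruct (edge_nonempty e Ee) as (y & _ & ey & _).
  exists y. split.
  - apply Heta. specialize (He y ey). specialize (HO v q Ov Oq). simpl in HO.
    pose proof (metric_tri d Hd (emb v p) (emb v q) y). lra.
  - exists e. split; auto. apply (E_level i). split; auto. split; [eauto | ].
    intros sm. apply nS. apply small_mono with (2 * i + b + 3)%nat; auto. lia.
Qed.

Lemma class_closure x : closure (bigU E) x <-> ground x \/ bigU E x.
Proof.
  split.
  - intros Hx. destruct (classic (ground x)) as [ | Gx]; auto. right.
    apply NNPP in Gx. destruct Gx as (e & Ee & ex).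
    destruct (Hx e) as (y & ey & e' & Ee' & ey'); auto; [apply Ee | ].
    exists e. split; auto. replace e with e'; auto.
    apply (edges_meet_eq d Hd K cX lc Gne e' e y); auto.
  - intros [Gx | Hx]; [apply class_dense | apply subset_closure]; auto.
Qed.

(** The connecting set [T] consists of the sets [{w} * O] for [w] in one class [W] and the edges of
    [E] in [U] attached to them. A separation of [T] keeps each [{w} * O] whole, so it induces a
    clopen cut of [W], and [cut_level_edge] gives an edge of [T] across it. *)
Lemma ground_join v p U :
  is_open U -> U (emb v p) ->
  exists W, is_open W /\ W (emb v p) /\ forall g, ground g -> W g ->
    exists C, connected_set C /\ C (emb v p) /\ C g /\
      forall y, C y -> (ground y \/ bigU E y) /\ U y.
Proof.
  intros oU Ux.
  destruct (emb_cont U v p oU Ux) as (O1 & O1' & oO1 & oO1' & O1v & O1p & HO1).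
  destruct (connected_nbhd p O1' lcP oO1' O1p) as (O & oO & Op & HO & cO).
  destruct (emb_box O1 O oO1 oO) as (U1 & oU1 & HU1).
  destruct (open_ball_in d Hd (fun y => U y /\ U1 y) (emb v p)) as (eta & eta0 & Heta).
  { apply open_inter; auto. }
  { split; auto. apply HU1. auto. }
  destruct (emb_cont (fun y => d (emb v p) y < eta / 2) v p)
    as (O2 & O2' & oO2 & oO2' & O2v & O2p & HO2).
  { apply (ball_open d Hd). }
  { rewrite (metric_refl d Hd). lra. }
  (* With radii below half the gap [c0] of [A0], neither the class [W] nor the centres of the balls
     used later leave [A0]. *)
  destruct (zdV v (fun w => O1 w /\ O2 w)) as (A0 & clA0 & A0v & HA0).
  { apply open_inter; auto. }
  { auto. }
  destruct (clopen_separation A0 clA0) as (c0 & c0pos & Hc0).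
  destruct (r_lim (Rmin (eta / 2) (c0 / 2))) as (N1 & HN1).
  { apply Rmin_glb_lt; lra. }
  destruct (Q_dense (fun q => O q /\ O2' q)) as (N2 & HN2).
  { apply open_inter; auto. }
  { eauto. }
  set (N := (N1 + N2)%nat).
  (* One height in [O] per level is enough, because [O] is connected. Below [N] the values are
     arbitrary. *)
  set (qq := fun i => epsilon (inhabits p) (fun q => In q (Q (2 * i + b)) /\ O q /\ O2' q)).
  assert (Hqq : forall i, (N <= i)%nat -> In (qq i) (Q (2 * i + b)) /\ O (qq i) /\ O2' (qq i)).
  { intros i Hi. apply (epsilon_spec (inhabits p) (fun q => In q (Q (2 * i + b)) /\ O q /\ O2' q)).
    apply HN2. lia. }
  assert (Hr : forall i, (N <= i)%nat -> r (2 * i + b) < eta / 2 /\ 2 * r (2 * i + b) < c0).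
  { intros i Hi. specialize (HN1 (2 * i + b)%nat ltac:(lia)).
    pose proof (Rmin_l (eta / 2) (c0 / 2)). pose proof (Rmin_r (eta / 2) (c0 / 2)). lra. }
  set (W := link (r (2 * N + b)) (qq N) v).
  assert (clW : clopen W) by (apply link_clopen; auto).
  assert (WA0 : forall w, W w -> A0 w).
  { intros w Ww. apply (link_clopen_side (2 * N + b) (qq N) v w A0 c0); auto. apply Hr. lia. }
  assert (Wv : W v) by apply link_refl.
  set (T := fun y => (exists w o, W w /\ O o /\ y = emb w o) \/
    exists e, E e /\ e y /\ (forall z, e z -> U z) /\
      exists w o, W w /\ O o /\ closure e (emb w o)).
  assert (Tfib : forall w o, W w -> O o -> T (emb w o)) by (intros; left; eauto).
  assert (cT : connected_set T).
  { apply connected_intro. intros A B x y oA oB cov dis Tx Ax Ty By.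
    (* [A] and [B] are quantified afresh because both orders of the separation are needed. *)
    assert (fib : forall (A B : X -> Prop) w o, is_open A -> is_open B ->
      (forall z, T z -> A z \/ B z) -> (forall z, T z -> A z -> B z -> False) ->
      W w -> O o -> A (emb w o) -> forall o', O o' -> A (emb w o')).
    { clear A B oA oB cov dis Ax By. intros A B w o oA oB cov dis Ww Oo Ao o' Oo'.
      assert (pull : forall A : X -> Prop, is_open A -> is_open (fun o => A (emb w o))).
      { clear A oA cov dis Ao. intros A oA. apply open_local. intros q Aq.
        destruct (emb_cont A w q oA Aq) as (G & G' & oG & oG' & Gw & Gq & HG).
        exists G'. auto. }
      apply (connected_side O (fun o => A (emb w o)) (fun o => B (emb w o)) o o'); auto.
      intros q Oq. apply dis. auto. }
    assert (touch : forall (A B : X -> Prop) z, is_open A -> is_open B ->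
      (forall z, T z -> A z \/ B z) -> (forall z, T z -> A z -> B z -> False) ->
      T z -> A z -> exists w, W w /\ A (emb w p)).
    { clear A B oA oB cov dis Ax By. intros A B z oA oB cov dis Tz Az.
      assert (G : exists w o, W w /\ O o /\ A (emb w o)).
      { destruct Tz as [(w & o & Ww & Oo & ->) | (e & Ee & ez & eU & w & o & Ww & Oo & cl)].
        - exists w, o. auto.
        - exists w, o. repeat split; auto.
          assert (eT : forall y, e y \/ y = emb w o -> T y).
          { intros y' [ey | ->]; auto. right. exists e. eauto 10. }
          apply (connected_side (fun y => e y \/ y = emb w o) A B z); eauto.
          apply connected_add_point; auto. apply edge_connected. auto. }
      destruct G as (w & o & Ww & Oo & Aw). exists w. split; auto.
      apply (fib A B w o); auto. }
    destruct (touch A B x) as (w1 & Ww1 & Aw1); auto.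
    destruct (touch B A y) as (w2 & Ww2 & Bw2); auto.
    { intros z Tz. destruct (cov z Tz); auto. }
    { intros z Tz Bz Az. eauto. }
    assert (pull : forall A : X -> Prop, is_open A -> is_open (fun w => A (emb w p))).
    { intros A' oA'. apply open_local. intros w Aw.
      destruct (emb_cont A' w p oA' Aw) as (G & G' & oG & oG' & Gw & Gq & HG).
      exists G. auto. }
    (* The separation read at height [p]. It is clopen in all of [V] because [W] is clopen and [B]
       takes up the rest of [W]. *)
    set (S := fun w => W w /\ A (emb w p)).
    assert (clS : clopen S).
    { split.
      - apply open_inter; auto. apply clW.
      - replace (fun w => ~ S w) with (fun w => ~ W w \/ (W w /\ B (emb w p))).
        + apply open_or; [apply clW | apply open_inter; auto; apply clW].
        + apply pred_ext. intros w. unfold S. split.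
          * intros [nW | (Ww & Bw)] (Ww' & Aw); auto. apply (dis (emb w p)); auto.
          * intros nS. destruct (classic (W w)); auto. right. split; auto.
            destruct (cov (emb w p)); auto. tauto. }
    destruct (clopen_separation S clS) as (c & cpos & Hc).
    destruct (r_lim (c / 2)) as (M & HM); [lra | ].
    assert (S2 : ~ S w2). { intros (_ & Aw2). apply (dis (emb w2 p)); auto. }
    destruct (cut_level_edge b N qq) with (n := M) (i := N) (A := S) (v1 := w1) (v2 := w2) (c := c)
      as (m & e & u & x1 & p1 & x2 & p2 & Hm & Fe & He & c1 & c2 & S1 & nS2 & L1 & L2); auto.
    { intros i Hi. apply Hqq, Hi. }
    { specialize (HM (2 * (N + M) + b)%nat ltac:(lia)). lra. }
    { split; auto. }
    { apply link_trans with v; auto. apply link_sym; auto. }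
    destruct (Hr m Hm) as (r1 & r2). destruct (Hqq m Hm) as (_ & _ & Oq).
    assert (W1 : W x1) by apply S1.
    assert (W2 : W x2). { apply link_trans with w1; auto. }
    (* The centre is closer than [c0] to an end over [A0], so it lies over [A0] itself; this puts
       the ball into the [eta]-ball around [emb v p]. *)
    assert (A0u : A0 u).
    { apply NNPP. intros nA. pose proof (closure_ball_le d Hd _ _ _ _ He c1) as le.
      pose proof (Hc0 x1 u p1 (qq m) (WA0 _ W1) nA).
      rewrite (metric_sym d Hd) in H. pose proof (metric_pos d Hd (emb u (qq m)) (emb x1 p1)). lra. }
    assert (near : d (emb v p) (emb u (qq m)) < eta / 2) by (apply HO2; auto; apply HA0; auto).
    assert (eU : forall z, e z -> U z).
    { intros z ez. apply Heta. specialize (He z ez).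
      pose proof (metric_tri d Hd (emb v p) (emb u (qq m)) z). lra. }
    assert (endO : forall w q, closure e (emb w q) -> O q).
    { intros w q cl. pose proof (closure_ball_le d Hd _ _ _ _ He cl).
      pose proof (metric_tri d Hd (emb v p) (emb u (qq m)) (emb w q)).
      apply (HU1 w q). apply Heta. lra. }
    assert (Ee : E e) by (apply (E_level m); auto).
    assert (O1p1 : O p1) by eauto. assert (Op2 : O p2) by eauto.
    assert (A (emb x1 p1)) by (apply (fib A B x1 p); auto; apply S1).
    assert (A (emb x2 p2)).
    { assert (eT : forall z, e z \/ z = emb x1 p1 -> T z).
      { intros z [ez | ->]; auto. right. exists e. eauto 10. }
      assert (eT2 : forall z, (e z \/ z = emb x1 p1) \/ z = emb x2 p2 -> T z).
      { intros z [Hz | ->]; auto. }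
      apply (connected_side (fun z => (e z \/ z = emb x1 p1) \/ z = emb x2 p2) A B (emb x1 p1));
        eauto.
      apply connected_add_point.
      - apply connected_add_point; auto. apply edge_connected. auto.
      - apply (closure_incl e); auto. }
    apply nS2. split; auto. apply (fib A B x2 p2); auto. }
  destruct (emb_box W O) as (UW & oUW & HUW); auto. { apply clW. }
  exists UW. repeat split; auto.
  - apply HUW. auto.
  - intros g Gg Ug. destruct (emb_onto g Gg) as (w & o & ->). apply HUW in Ug.
    exists T. split; [auto | ]. split; [auto | ]. split; [apply Tfib; tauto | ].
    intros y [(w' & o' & Ww' & Oo' & ->) | (e & Ee & ey & eU & _)].
    + split; auto. apply HO1; auto. apply HA0, WA0, Ww'.
    + split; auto. right. exists e. auto.
Qed.

(** A point of an edge near a ground point is first moved along its edge to a nearby ground point by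
    boundary bumping; from there [ground_join] applies. *)
Lemma class_locally_connected : locally_connected_set (closure (bigU E)).
Proof.
  replace (closure (bigU E)) with (fun x => ground x \/ bigU E x)
    by (apply pred_ext; intros x; symmetry; apply class_closure).
  apply locally_connected_weak. intros x U Yx oU Ux.
  destruct (classic (ground x)) as [Gx | nGx].
  - destruct (emb_onto x Gx) as (v & p & ->).
    destruct (ground_join v p U oU Ux) as (W & oW & Wx & HW).
    destruct (connected_nbhd (emb v p) (fun y => U y /\ W y) lc) as (S & oS & Sx & HS & cS).
    { apply open_inter; auto. }
    { auto. }
    exists S. repeat split; auto. intros y Yy Sy.
    destruct (classic (ground y)) as [Gy | nGy].
    { apply HW; auto. apply HS. auto. }
    destruct Yy as [ | (e & Ee & ey)]; [tauto | ].
    destruct (connected_reach ground S y (emb v p)) as (g & D & Gg & Sg & cD & Dy & Dg & DS);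
      auto using open_not_ground.
    destruct (HW g Gg) as (C & cC & Cx & Cg & HC). { apply HS. auto. }
    assert (De : forall z, D z -> e z).
    { apply (connected_in_edge d Hd K cX lc Gne e D y); auto. apply DS. }
    exists (fun z => C z \/ (D z \/ z = g)). repeat split; auto.
    + apply (connected_union C (fun z => D z \/ z = g) g); auto.
      apply connected_add_point; auto.
    + destruct H as [Cz | [Dz | ->]]; [apply HC; auto | | auto]. right. exists e. auto.
    + destruct H as [Cz | [Dz | ->]]; [apply HC; auto | | apply HS; auto]. apply HS, DS, Dz.
  - destruct Yx as [ | (e & Ee & ex)]; [tauto | ].
    destruct (connected_nbhd x (fun y => U y /\ e y) lc) as (S & oS & Sx & HS & cS).
    { apply open_inter; auto. apply E_edge. auto. }
    { auto. }
    exists S. repeat split; auto. intros y Yy Sy. exists S. repeat split; auto.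
    + right. exists e. split; auto. apply HS. auto.
    + apply HS. auto.
Qed.

End EdgeClass.
End Scales.

(** * Choice of nets and radii, and the partition *)

Lemma disjoint_nets :
  exists Q : nat -> list P,
    (forall n q, In q (Q n) -> ~ In q (Q (S n))) /\
    (forall O : P -> Prop, is_open O -> (exists p, O p) ->
       exists N, forall n, (N <= n)%nat -> exists q, In q (Q n) /\ O q).
Proof.
  assert (net : forall (l : list P) eps, 0 < eps -> exists Q : list P,
    (forall q, In q Q -> ~ In q l) /\ forall p, exists q, In q Q /\ dP p q < eps).
  { intros l eps e0.
    destruct (compact_induction (fun U : P -> Prop => exists Q : list P,
      (forall q, In q Q -> ~ In q l) /\ forall p, U p -> exists q, In q Q /\ dP p q < eps) KP)
      as (Q & HQ & cov).
    - exists nil. split; [intros q [] | tauto].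
    - intros A B (Q & HQ & cov) (Q' & HQ' & cov'). exists (Q ++ Q'). split.
      + intros q Hq. apply in_app_or in Hq. destruct Hq; auto.
      + intros p [Ap | Bp]; [destruct (cov p Ap) as (q & Hq & lt)
                            | destruct (cov' p Bp) as (q & Hq & lt)];
          exists q; split; auto; apply in_or_app; auto.
    - intros A B AB (Q & HQ & cov). exists Q. auto.
    - intros p. destruct (perfectP (fun q => dP p q < eps / 2) l) as (q & Hq & ql).
      { apply (ball_open dP HdP). }
      { exists p. rewrite (metric_refl dP HdP). lra. }
      exists (fun q => dP p q < eps / 2). repeat split.
      + apply (ball_open dP HdP).
      + rewrite (metric_refl dP HdP). lra.
      + exists (q :: nil). split; [intros q' [<- | []]; auto | ].
        intros p' Hp'. exists q. split; [left; auto | ].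
        pose proof (metric_tri dP HdP p' p q). rewrite (metric_sym dP HdP p' p) in H. lra.
    - exists Q. split; auto. intros p. apply cov. exact I. }
  assert (pos : forall n, 0 < / INR (S n)).
  { intros n. apply Rinv_0_lt_compat, lt_0_INR. lia. }
  destruct (dependent_sequence
    (fun n (Q : list P) => forall p, exists q, In q Q /\ dP p q < / INR (S n))
    (fun _ Q Q' => forall q, In q Q' -> ~ In q Q)) as (Q & HQ).
  - destruct (net nil (/ INR 1)) as (Q & _ & cov); [apply pos | ]. exists Q. auto.
  - intros n Q _. destruct (net Q (/ INR (S (S n)))) as (Q' & HQ' & cov); [apply pos | ].
    exists Q'. auto.
  - exists Q. split.
    + intros n q Hq Hq'. apply (proj2 (HQ n) q Hq' Hq).
    + intros O oO (p & Op). destruct (open_ball_in dP HdP O p oO Op) as (eps & e0 & He).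
      destruct (archimed_cor1 eps e0) as (N & HN & N0). exists N. intros n Hn.
      destruct (proj1 (HQ n) p) as (q & Hq & lt). exists q. split; auto. apply He.
      apply Rlt_trans with (/ INR (S n)); auto. apply Rle_lt_trans with (/ INR N); auto.
      apply Rinv_le_contravar; [apply lt_0_INR | apply le_INR]; lia.
Qed.

(** The nets are fixed beforehand, as [r n] must respect both [Q n] and [Q (n + 1)]; this is the
    invariant of the recursion. The bounds for links and edge sizes depend on the previous radius
    and form the relation between consecutive terms. *)
Lemma scales_exist :
  exists (Q : nat -> list P) (r : nat -> R),
    (forall O : P -> Prop, is_open O -> (exists p, O p) ->
       exists N, forall n, (N <= n)%nat -> exists q, In q (Q n) /\ O q) /\
    (forall n, 0 < r n) /\
    (forall n, r (S n) <= r n) /\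
    (forall eps, 0 < eps -> exists N, forall n, (N <= n)%nat -> r n < eps) /\
    (forall n q q' v v', In q (Q n) -> In q' (Q (S n)) -> 2 * r n < d (emb v q) (emb v' q')) /\
    (forall n q v v' p p', In q (Q n) -> ~ link (r n) q v v' ->
       2 * r (S n) < d (emb v p) (emb v' p')) /\
    (forall n q v, In q (Q n) ->
       exists e, edge e /\ (forall y, e y -> d (emb v q) y < r n) /\ ~ small (r (S n)) e).
Proof.
  destruct disjoint_nets as (Q & Qdis & Qdense). exists Q.
  assert (pos : forall n, 0 < / INR (S n)).
  { intros n. apply Rinv_0_lt_compat, lt_0_INR. lia. }
  destruct (dependent_sequence
    (fun n r => 0 < r /\ r <= / INR (S n) /\
       forall q, In q (Q n) -> forall q', In q' (Q (S n)) -> forall v v',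
         2 * r < d (emb v q) (emb v' q'))
    (fun n r r' => r' <= r /\
       (forall q, In q (Q n) -> forall v v' p p', ~ link r q v v' ->
          2 * r' < d (emb v p) (emb v' p')) /\
       (forall q, In q (Q n) -> forall v,
          exists e, edge e /\ (forall y, e y -> d (emb v q) y < r) /\ ~ small r' e)))
    as (r & Hr).
  - destruct (slice_separation (Q 0%nat) (Q 1%nat)) as (c & c0 & Hc); auto.
    exists (Rmin c (/ INR 1)). pose proof (Rmin_l c (/ INR 1)). pose proof (Rmin_r c (/ INR 1)).
    split; [apply Rmin_glb_lt; auto; apply (pos 0%nat) | ]. split; auto.
    intros q Hq q' Hq' v v'. specialize (Hc q Hq q' Hq' v v'). lra.
  - intros n r (r0 & _ & _).
    destruct (slice_separation (Q (S n)) (Q (S (S n)))) as (c1 & c1p & Hc1); auto.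
    destruct (link_separation r (Q n) r0) as (c2 & c2p & Hc2).
    destruct (small_edge_uniform r (Q n) r0) as (c3 & c3p & Hc3).
    set (c := Rmin (Rmin c1 c2) (Rmin c3 (Rmin r (/ INR (S (S n)))))).
    assert (B : 0 < c /\ c <= c1 /\ c <= c2 /\ c <= c3 /\ c <= r /\ c <= / INR (S (S n))).
    { pose proof (Rmin_l (Rmin c1 c2) (Rmin c3 (Rmin r (/ INR (S (S n)))))).
      pose proof (Rmin_r (Rmin c1 c2) (Rmin c3 (Rmin r (/ INR (S (S n)))))).
      pose proof (Rmin_l c1 c2). pose proof (Rmin_r c1 c2).
      pose proof (Rmin_l c3 (Rmin r (/ INR (S (S n))))).
      pose proof (Rmin_r c3 (Rmin r (/ INR (S (S n))))).
      pose proof (Rmin_l r (/ INR (S (S n)))). pose proof (Rmin_r r (/ INR (S (S n)))).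
      fold c in H, H0. split; [ | repeat split; lra].
      unfold c. repeat apply Rmin_glb_lt; auto. }
    destruct B as (B0 & B1 & B2 & B3 & B4 & B5).
    exists c. split; [split; [auto | split; [auto | ]] | split; [auto | split]].
    + intros q Hq q' Hq' v v'. specialize (Hc1 q Hq q' Hq' v v'). lra.
    + intros q Hq v v' p p' nL. specialize (Hc2 q Hq v v' p p' nL). lra.
    + intros q Hq v. destruct (Hc3 q Hq v) as (e & Ee & He & nS). exists e. split; [auto | split; auto].
      intros (x & Hx). apply nS. exists x. intros y ey. specialize (Hx y ey). lra.
  - exists r. split; [exact Qdense | ]. split; [apply Hr | ]. split; [apply Hr | ].
    split; [ | split; [ | split]].
    + intros eps e0. destruct (archimed_cor1 eps e0) as (N & HN & N0). exists N. intros n Hn.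
      destruct (Hr n) as ((_ & Hle & _) & _).
      apply Rle_lt_trans with (/ INR (S n)); auto. apply Rle_lt_trans with (/ INR N); auto.
      apply Rinv_le_contravar; [apply lt_0_INR | apply le_INR]; lia.
    + intros n q q' v v' Hq Hq'. apply (proj1 (Hr n)); auto.
    + intros n q v v' p p' Hq nL. apply (proj1 (proj2 (proj2 (Hr n))) q Hq v v' p p' nL).
    + intros n q v Hq. apply (proj2 (proj2 (proj2 (Hr n))) q Hq v).
Qed.

Lemma edge_partition :
  exists E1 E2 : (X -> Prop) -> Prop,
    (forall e, edge e <-> E1 e \/ E2 e) /\ (forall e, E1 e -> E2 e -> False) /\
    forall E : (X -> Prop) -> Prop, E = E1 \/ E = E2 ->
      (forall x, ground x -> closure (bigU E) x) /\
      (forall x, closure (bigU E) x <-> ground x \/ bigU E x) /\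
      locally_connected_set (closure (bigU E)).
Proof.
  destruct scales_exist as (Q & r & Qdense & rpos & rstep & rlim & rslices & rlink & redge).
  set (F := level_edge Q r).
  assert (class : forall b E, (forall e, E e -> edge e) -> (forall i e, F (2 * i + b)%nat e -> E e) ->
    (forall x, ground x -> closure (bigU E) x) /\
    (forall x, closure (bigU E) x <-> ground x \/ bigU E x) /\
    locally_connected_set (closure (bigU E))).
  { intros b E HE HF. split; [ | split].
    - apply (class_dense Q r) with b; auto.
    - apply (class_closure Q r) with b; auto.
    - apply (class_locally_connected Q r) with b; auto. }
  (* Edges of no level at all go to the second class. *)
  exists (fun e => edge e /\ exists i, F (2 * i)%nat e),
         (fun e => edge e /\ ~ exists i, F (2 * i)%nat e).
  split; [ | split].
  - intros e. split; [ | tauto]. intros Ee. destruct (classic (exists i, F (2 * i)%nat e)); auto.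
  - tauto.
  - intros E [-> | ->].
    + apply (class 0%nat); [tauto | ]. intros i e He.
      replace (2 * i + 0)%nat with (2 * i)%nat in He by lia.
      split; [apply He | eauto].
    + apply (class 1%nat); [tauto | ]. intros i e He. split; [apply He | ].
      (* The two indices have opposite parity, so they never differ by 2. *)
      intros (j & Hj). destruct (Nat.lt_total (2 * j) (2 * i + 1)) as [lt | [eq | lt]]; [ | lia | ].
      * apply (level_edge_disjoint Q r) with (2 * j)%nat (2 * i + 1)%nat e; auto. lia.
      * apply (level_edge_disjoint Q r) with (2 * i + 1)%nat (2 * j)%nat e; auto. lia.
Qed.

End Product.

(** * Product coordinates on the ground space and the final assembly *)

Lemma product_embedding (X V P : TopSpace) :
  homeomorphic_to_product X ground V P ->
  exists emb : V -> P -> X,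
    (forall v p, ground (emb v p)) /\
    (forall x, ground x -> exists v p, x = emb v p) /\
    (forall v p v' p', emb v p = emb v' p' -> v = v' /\ p = p') /\
    (forall O O', is_open O -> is_open O' ->
       exists U, is_open U /\ forall v p, U (emb v p) <-> O v /\ O' p) /\
    (forall U v p, is_open U -> U (emb v p) ->
       exists O O', is_open O /\ is_open O' /\ O v /\ O' p /\
         forall v' p', O v' -> O' p' -> U (emb v' p')).
Proof.
  intros (f & g & gf & fg & fopen & gopen).
  exists (fun v p => proj1_sig (g (v, p))). repeat split.
  - intros v p. apply (proj2_sig (g (v, p))).
  - intros x Gx. exists (fst (f (exist _ x Gx))), (snd (f (exist _ x Gx))).
    rewrite <- surjective_pairing, gf. reflexivity.
  - apply eq_sig_hprop in H; [ | intros; apply proof_irrelevance].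
    pose proof (fg (v, p)) as H1. rewrite H, fg in H1. congruence.
  - apply eq_sig_hprop in H; [ | intros; apply proof_irrelevance].
    pose proof (fg (v, p)) as H1. rewrite H, fg in H1. congruence.
  - intros O O' oO oO'.
    destruct (fopen (fun q => O (fst q) /\ O' (snd q))) as (U & oU & HU).
    + intros v p (Ov & Op). exists O, O'. repeat split; auto.
    + exists U. split; auto. intros v p. rewrite <- HU, fg. reflexivity.
  - intros U v p oU Uvp. destruct (gopen U oU v p Uvp) as (O & O' & oO & oO' & Ov & Op & HO).
    exists O, O'. auto 6.
Qed.

Theorem theorem4 (X : TopSpace) (V P : TopSpace) :
  peano_graph X ->
  compact_set (@full V) -> zero_dimensional V -> metrizable_set (@full V) ->
  peano_continuum P -> (exists p q : P, p <> q) ->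
  homeomorphic_to_product X ground V P ->
  exists E1 E2 : (X -> Prop) -> Prop,
    (forall e, E1 e -> edge e) /\ (forall e, E2 e -> edge e) /\
    (forall e, edge e -> E1 e \/ E2 e) /\
    (forall e, E1 e -> E2 e -> False) /\
    (forall e e', (forall x, e x <-> e' x) -> E1 e -> E1 e') /\
    (forall e e', (forall x, e x <-> e' x) -> E2 e -> E2 e') /\
    (forall Ei : (X -> Prop) -> Prop, (Ei = E1 \/ Ei = E2) ->
       (forall x, ground x -> closure (bigU Ei) x) /\
       (forall x, closure (bigU Ei) x <-> (ground x \/ bigU Ei x)) /\
       locally_connected_set (closure (bigU Ei))).
Proof.
  intros ((_ & K & cX & lc & mX) & dense) KV zdV _ (_ & KP & cP & lcP & mP) (p0 & q0 & ne) homeo.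
  assert (main : exists E1 E2 : (X -> Prop) -> Prop,
    (forall e, edge e <-> E1 e \/ E2 e) /\ (forall e, E1 e -> E2 e -> False) /\
    forall E : (X -> Prop) -> Prop, E = E1 \/ E = E2 ->
      (forall x, ground x -> closure (bigU E) x) /\
      (forall x, closure (bigU E) x <-> ground x \/ bigU E x) /\
      locally_connected_set (closure (bigU E))).
  { destruct (classic (exists y : X, ground y)) as [Gne | none].
    - destruct (metrizable_metrizes X mX) as (d & Hd).
      destruct (metrizable_metrizes P mP) as (dP & HdP).
      destruct (product_embedding X V P homeo)
        as (emb & emb_ground & emb_onto & emb_inj & emb_box & emb_cont).
      apply (edge_partition d Hd K cX lc Gne dense emb emb_ground emb_onto emb_inj emb_box emb_cont
        KV zdV KP lcP) with dP; auto.
      intros O l oO HO. apply (open_avoids_list dP HdP p0 q0 l cP ne O oO HO).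
    (* With empty ground space edges may overlap: in a circle the complement of each point is an
       edge. All edges go to one class, and the closure of the other is empty. *)
    - assert (nG : forall x : X, ~ ground x) by (intros x Gx; eauto).
      exists edge, (fun _ => False). split; [tauto | split; [tauto | ]].
      intros E [-> | ->].
      + split; [intros x Gx; destruct (nG x Gx) | ]. split.
        * intros x. split; [ | auto]. intros _. right. apply NNPP. apply nG.
        * replace (closure (bigU edge)) with (@full X); auto.
          apply pred_ext. intros x. split; [auto | intros _; exact I].
      + assert (empty : forall x : X, ~ closure (bigU (fun _ => False)) x).
        { intros x Hx. destruct (Hx (fun _ => True)) as (y & _ & e & [] & _); auto.
          apply open_full. }
        split; [intros x Gx; destruct (nG x Gx) | ]. split.
        * intros x. split; intros H; [destruct (empty x H) | ].
          destruct H as [Gx | (e & [] & _)]. destruct (nG x Gx).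
        * intros x U Hx. destruct (empty x Hx). }
  destruct main as (E1 & E2 & cover & disj & class). exists E1, E2.
  split; [intros e He; apply cover; auto | ].
  split; [intros e He; apply cover; auto | ].
  split; [intros e He; apply cover; auto | ].
  split; [exact disj | ].
  split; [intros e e' eq; rewrite (pred_ext e e' eq); auto | ].
  split; [intros e e' eq; rewrite (pred_ext e e' eq); auto | ].
  exact class.
Qed.
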